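(* Let $|\psi\rangle$ and $|\varphi\rangle$ be two $n\times n$ states with $\psi\prec\varphi$ and normal decompositions $\psi=(\psi^1,\ldots,\psi^m)$ and $\varphi=(\varphi^1,\ldots,\varphi^m)$, with associated sets $I_{\psi,\varphi},D_{\psi,\varphi},I'_{\psi,\varphi},D'_{\psi,\varphi}$. Let $|\chi\rangle$ be an auxiliary state, with positive Schmidt coefficients and not maximally entangled, with a decomposition $$\chi=(\chi^{D_0},\chi^{\{k_1\}},\chi^{D_1},\ldots,\chi^{\{k_p\}},\chi^{D_p})=\bigoplus_{i\in I'_{\psi,\varphi}\cup D'_{\psi,\varphi}}\chi^i$$ (terms with $D_i=\emptyset$ omitted). If $$\frac{\chi^{\{i\}}}{\chi^J}\sqsupset\frac{\varphi^i}{\varphi^{J_i}}\quad\text{for all } i\in I_{\psi,\varphi},\ J\in D'_{\psi,\varphi},\ \text{where } J_i=\arg\min_{k\in J}|i-k|,$$ $$\min\{l_u(|\chi^J\rangle):J\in D'_{\psi,\varphi}\}>\max\{g_u(|\varphi^i\rangle):i\in D_{\psi,\varphi}\},$$ and $$\min\{l_u(|\chi^{\{i\}}\rangle):i\in I_{\psi,\varphi}\}>\max\bigcup_{J\in D'_{\psi,\varphi}}\{g_u(|\varphi^{\max J}\rangle),\,g_u(|\varphi^{\min J}\rangle)\}$$ (conditions over an empty $I_{\psi,\varphi}$ being vacuous), then $|\chi\rangle$ can do partial entanglement recovery for the transformation of $|\psi\rangle$ to $|\varphi\rangle$. Moreover, if $|\chi\rangle$ satisfies these three conditions, then there exists a positive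 number $\delta$ such that for any state $|\omega\rangle$ with a decomposition $\omega=\bigoplus_{i\in I'_{\psi,\varphi}\cup D'_{\psi,\varphi}}\omega^i$ (with $\dim\omega^i=\dim\chi^i$) satisfying (i) $\omega^i=\chi^i$ for any $i\in I'_{\psi,\varphi}$; and (ii) $\|\omega^i-\chi^i\|<\delta$ and $\sum\omega^i=\sum\chi^i$ (equality of sums of components) for any $i\in D'_{\psi,\varphi}$, the transformation of $|\psi\rangle\otimes|\chi\rangle$ to $|\varphi\rangle\otimes|\omega\rangle$ can be realized with certainty by LOCC, i.e., $|\psi\rangle\otimes|\chi\rangle\rightarrow|\varphi\rangle\otimes|\omega\rangle$.
   Context: For a real vector $x$ of dimension $n$, $x^{\downarrow}$ (resp. $x^{\uparrow}$) is its non-increasing (resp. non-decreasing) rearrangement and $e_l(x)$ is the sum of its $l$ largest components. For $n$-dimensional $x,y$: $x\prec y$ means $e_l(x)\le e_l(y)$ for $1\le l\le n-1$ and $e_n(x)=e_n(y)$; $x\lhd y$ means $e_l(x)<e_l(y)$ for $1\le l\le n-1$ and $e_n(x)=e_n(y)$. An $n\times n$ state $|\psi\rangle$ is a bipartite pure state in $\mathbb{C}^n\otimes\mathbb{C}^n$ with Schmidt decomposition $\sum_i\sqrt{\alpha_i}|i_A\rangle|i_B\rangle$; the $\alpha_i$ are called its Schmidt coefficients and $\psi=(\alpha_1,\dots,\alpha_n)$ is its Schmidt coefficient (probability) vector, arranged non-increasingly. It is maximally entangled if all $\alpha_i=1/n$. The vectors considered are in non-increasing order. A segment of such a vector is treated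 as the vector of an unnormalized state. The vector of $|\psi\rangle\otimes|\chi\rangle$ is the Kronecker product $\psi\otimes\chi$ (up to order). LOCC means local operations and classical communication; $|\psi\rangle\to|\varphi\rangle$ means deterministic transformability by LOCC, which by Nielsen's theorem is equivalent to $\psi\prec\varphi$. $\|\cdot\|$ is the Euclidean norm. Partial entanglement recovery: a $k\times k$ state $|\chi\rangle$ can do partial entanglement recovery for the transformation of $|\psi\rangle$ to $|\varphi\rangle$ if there is a $k\times k$ state $|\omega\rangle$ with $\psi\otimes\chi\prec\varphi\otimes\omega$, $\omega\prec\chi$ and $\omega^{\downarrow}\ne\chi^{\downarrow}$. Uniformity indices of a (possibly unnormalized) state with distinct components $\alpha_1'>\dots>\alpha_r'\ge0$: if $r>1$, $l_u=\min_{1\le i<r}\alpha'_{i+1}/\alpha'_i$ and $g_u=\alpha'_r/\alpha'_1$; if $r=1$ both equal $1$. Decompositions: a decomposition of a vector $x$ is a writing of $x$ as a concatenation (direct sum, $\oplus$) of consecutive blocks of dimension at least one. If $x\prec y$ (both non-increasing), their normal decompositions are the unique decompositions $x=(x^1,\dots,x^m)$, $y=(y^1,\dots,y^m)$ with $\dim x^i=\dim y^i$ such that for each $i$ either $x^i\lhd y^i$ or $x^i=y^i$, and there is no $i$ with both $x^i=y^i$ and $x^{i+1}=y^{i+1}$. Then $I_{x,y}=\{i: x^i=y^i\}$ and $D_{x,y}=\{i:x^i\lhd y^i\}$, where an index with $x^i=y^i$ (including one-dimensional blocks) is counted in $I_{x,y}$ only, so that these sets partition $\{1,\dots,m\}$.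 Grouped index sets: write $I_{\psi,\varphi}=\{k_1<\dots<k_p\}$, $k_0=0$, $k_{p+1}=m+1$, and $D_i=\{s: k_i+1\le s\le k_{i+1}-1\}$ for $0\le i\le p$. Set $D'_{\psi,\varphi}=\{D_i: D_i\ne\emptyset,\ 0\le i\le p\}$ and $I'_{\psi,\varphi}=\{\{i\}: i\in I_{\psi,\varphi}\}$ (if $I_{\psi,\varphi}=\emptyset$, then $D'_{\psi,\varphi}=\{\{1,\dots,m\}\}$). The elements of $I'_{\psi,\varphi}\cup D'_{\psi,\varphi}$ serve as indices of blocks, ordered naturally as $D_0<\{k_1\}<D_1<\{k_2\}<\dots<\{k_p\}<D_p$ (empty terms omitted). For $i\in I_{\psi,\varphi}$ and $J\in D'_{\psi,\varphi}$ the element $J_i$ of $J$ nearest to $i$ is unique; $\max J$ and $\min J$ are the largest and smallest elements of $J$. Embedding relation: $x\sqsubset y$ (equivalently $y\sqsupset x$) means $x^{\downarrow}_1<y^{\downarrow}_1$ and $x^{\uparrow}_1>y^{\uparrow}_1$. The formal expression $\frac{x'}{x''}\sqsupset\frac{y'}{y''}$ means $x'\otimes y''\sqsupset x''\otimes y'$.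
   Formalization: The first claim (partial entanglement recovery) is proved under the added hypothesis that some χ^J with J in D' has two distinct components; without it the claim fails, e.g. ψ=(40,31,10)/81, φ=(60,11,10)/81, χ=(2/3;1/3). *)

(* Defs.v *)
From HB Require Import structures.
From mathcomp Require Import all_boot all_order all_algebra.
From mathcomp Require Import complex mxtens.

Set Implicit Arguments.
Unset Strict Implicit.
Unset Printing Implicit Defensive.

Import Order.TTheory GRing.Theory Num.Theory.
Local Open Scope ring_scope.
Local Open Scope complex_scope.

(** Real vectors are sequences (tuples when the dimension is fixed). *)

Section Vectors.
Variable R : rcfType.
Implicit Types x y : seq R.

Definition decr x : seq R := sort >=%R x.
Definition incr x : seq R := sort <=%R x.

Definition e_sum (l : nat) x : R := \sum_(a <- take l (decr x)) a.

Definition majorized x y : Prop :=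
  [/\ size x = size y,
      forall l, (1 <= l <= (size x).-1)%N -> e_sum l x <= e_sum l y
    & e_sum (size x) x = e_sum (size x) y].

Definition strictly_majorized x y : Prop :=
  [/\ size x = size y,
      forall l, (1 <= l <= (size x).-1)%N -> e_sum l x < e_sum l y
    & e_sum (size x) x = e_sum (size x) y].

Definition kron x y : seq R := [seq a * b | a <- x, b <- y].

Definition vsum x : R := \sum_(a <- x) a.

(* For vectors of the same dimension, as [zip] truncates. *)
Definition eucl_dist x y : R :=
  Num.sqrt (\sum_(p <- zip x y) (p.1 - p.2) ^+ 2).

Definition max_entangled x : bool := all (pred1 (size x)%:R^-1) x.

Definition embedded x y : bool :=
  (nth 0 (decr x) 0 < nth 0 (decr y) 0) && (nth 0 (incr y) 0 < nth 0 (incr x) 0).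

(* The formal relation x' / x'' "sqsupset" y' / y''. *)
Definition ratio_embeds x' x'' y' y'' : bool :=
  embedded (kron x'' y') (kron x' y'').

Definition distinct x : seq R := decr (undup x).

(* The vectors have nonnegative entries, so consecutive ratios are below 1:
   the unit 1 of the minimum only matters when there is a single distinct
   component, where it gives the prescribed value. *)
Definition l_u x : R :=
  let s := distinct x in
  \big[Num.min/1]_(i < (size s).-1) (nth 0 s i.+1 / nth 0 s i).

Definition g_u x : R :=
  let s := distinct x in
  if (1 < size s)%N then last 0 s / head 0 s else 1.

Definition decomposition x (xs : seq (seq R)) : Prop :=
  flatten xs = x /\ [::] \notin xs.

End Vectors.

(** Normal decompositions. Blocks are numbered from 1. *)

Section Blocks.
Variable R : rcfType.
Implicit Types xs ys zs : seq (seq R).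

Definition block xs (i : nat) : seq R := nth [::] xs i.-1.

Definition normal_decompositions (x y : seq R) xs ys : Prop :=
  [/\ decomposition x xs, decomposition y ys, shape xs = shape ys,
      forall i, (1 <= i <= size xs)%N ->
        strictly_majorized (block xs i) (block ys i) \/ block xs i = block ys i
    & forall i, (1 <= i < size xs)%N ->
        ~ (block xs i = block ys i /\ block xs i.+1 = block ys i.+1)].

Definition I_set xs ys : seq nat :=
  [seq i <- iota 1 (size xs) | block xs i == block ys i].
Definition D_set xs ys : seq nat :=
  [seq i <- iota 1 (size xs) | block xs i != block ys i].

(* k_0 = 0 < k_1 < ... < k_p < k_(p+1) = m + 1 *)
Definition k_ xs ys (j : nat) : nat :=
  nth 0%N (0%N :: rcons (I_set xs ys) (size xs).+1) j.

Definition D_ xs ys (j : nat) : seq nat :=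
  [seq s <- iota 1 (size xs) | (k_ xs ys j + 1 <= s <= k_ xs ys j.+1 - 1)%N].

Definition I_grp xs ys : seq (seq nat) := [seq [:: i] | i <- I_set xs ys].
Definition D_grp xs ys : seq (seq nat) :=
  [seq G <- [seq D_ xs ys j | j <- iota 0 (size (I_set xs ys)).+1] | G != [::]].

(* D_0, {k_1}, D_1, ..., {k_p}, D_p, without the empty terms. *)
Definition groups xs ys : seq (seq nat) :=
  [seq G <- D_ xs ys 0 ::
     flatten [seq [:: [:: k_ xs ys j]; D_ xs ys j]
             | j <- iota 1 (size (I_set xs ys))] | G != [::]].

(* zs is a decomposition indexed by [groups xs ys]. *)
Definition gblock xs ys zs (G : seq nat) : seq R :=
  nth [::] zs (index G (groups xs ys)).

Definition nearest (i : nat) (J : seq nat) (j : nat) : bool :=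
  (j \in J) && all (fun k => `|i%:Z - j%:Z| <= `|i%:Z - k%:Z|) J.

Definition max_idx (J : seq nat) : nat := \max_(j <- J) j.
Definition min_idx (J : seq nat) : nat := \big[minn/max_idx J]_(j <- J) j.

End Blocks.

(** Bipartite pure states and LOCC. A vector of C^a (x) C^b is represented by
    its a x b matrix of amplitudes; operators A and B of the two parties map
    M to A *m M and M *m B^T, and the tensor product of two bipartite states
    (first factors held by the first party) is the Kronecker product. *)

Section States.
Variable R : rcfType.

(* M = sum_i sqrt(x_i) u_i v_i^T, where u_i and v_i are the columns of the
   unitary matrices U and V (the two Schmidt bases). Since sum_i x_i = 1, the
   state M has norm one. *)
Definition state_with_schmidt n (M : 'M[R[i]]_n) (x : n.-tuple R) : Prop :=
  [/\ sorted >=%R x, all (fun a => 0 <= a) x, \sum_(a <- x) a = 1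
    & exists U V : 'M[R[i]]_n,
        [/\ U \is unitarymx, V \is unitarymx
          & M = U *m diag_mx (\row_j (Num.sqrt (tnth x j))%:C) *m V^T]].

Definition kraus_complete c a d (A : 'I_c -> 'M[R[i]]_(d, a)) : Prop :=
  \sum_(o < c) map_mx Num.conj (A o)^T *m A o = 1%:M.

(* Finite-round LOCC protocols turning M into the target N with certainty.
   Post-measurement states are not renormalized, so every branch has to end in
   a scalar multiple of N, the scalar being 0 on branches of probability 0. *)
Inductive LOCC a' b' (N : 'M[R[i]]_(a', b')) :
    forall a b : nat, 'M[R[i]]_(a, b) -> Prop :=
| LOCC_done (z : R[i]) : LOCC N (z *: N)
| LOCC_left a b (M : 'M[R[i]]_(a, b)) c d (A : 'I_c -> 'M[R[i]]_(d, a)) :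
    kraus_complete A -> (forall o, LOCC N (A o *m M)) -> LOCC N M
| LOCC_right a b (M : 'M[R[i]]_(a, b)) c d (B : 'I_c -> 'M[R[i]]_(d, b)) :
    kraus_complete B -> (forall o, LOCC N (M *m (B o)^T)) -> LOCC N M.

Definition transforms a b a' b' (M : 'M[R[i]]_(a, b)) (N : 'M[R[i]]_(a', b')) :=
  LOCC N M.

Definition partial_recovery n k (psi phi : n.-tuple R) (chi : k.-tuple R) : Prop :=
  exists (Omega : 'M[R[i]]_k) (omega : k.-tuple R),
    [/\ state_with_schmidt Omega omega,
        majorized (kron psi chi) (kron phi omega),
        majorized omega chi
      & decr omega <> decr chi].

End States.

(* Main.v *)
(** Write e_l(psi (x) chi) = sum_j chi_j e_{h j}(psi) for an optimal selection h
    of l products, taking the h j largest components of psi against chi_j. The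
    same h gives e_l(psi (x) chi) <= sum_j chi_j e_{h j}(phi) <= e_l(phi (x) chi).
    If both inequalities are equalities, then no h j lies strictly inside a
    strict block of phi, and h is optimal for phi too. Optimality and the
    conditions on the uniformity indices forbid that a strict block be fully
    taken against one component of a group of chi and left untouched against
    another one. Together with the embedding conditions this forces h to be
    constant on each group chi^J, J in D'. Hence sum_j omega_j e_{h j}(phi)
    depends only on the sums of the blocks of omega, and
    e_l(psi (x) chi) <= e_l(phi (x) omega). For the finitely many other l the
    inequality e_l(psi (x) chi) < e_l(phi (x) chi) is strict and survives a small
    perturbation of chi. Majorization is turned into a protocol by T-transforms,
    each of which is one two-outcome measurement. *)

Require Import Defs.
From HB Require Import structures.
From mathcomp Require Import all_boot all_order all_algebra.
From mathcomp Require Import perm complex mxtens.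
From mathcomp Require Import zify ring lra.

Set Implicit Arguments.
Unset Strict Implicit.
Unset Printing Implicit Defensive.

Import Order.TTheory GRing.Theory Num.Theory.
Local Open Scope ring_scope.
Local Open Scope complex_scope.

(** * Protocols *)

Section Protocols.
Variable R : rcfType.

(** Operators act linearly and no branch is renormalized, so a scalar passes through every
    measurement and only changes the factors at the ends of the branches. *)
Lemma LOCC_scale a' b' (N : 'M[R[i]]_(a', b')) a b (M : 'M[R[i]]_(a, b)) z :
  LOCC N M -> LOCC N (z *: M).
Proof.
elim=> {a b M}; first by move=> z'; rewrite scalerA; apply: LOCC_done.
- move=> a b M c d A KA _ IH; apply: (LOCC_left KA) => o.
  by rewrite -scalemxAr; apply: IH.
- move=> a b M c d B KB _ IH; apply: (LOCC_right KB) => o.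
  by rewrite -scalemxAl; apply: IH.
Qed.

(** The second protocol is run at the end of every branch of the first, where the state is a scalar
    multiple of [N]; [LOCC_scale] absorbs this scalar. *)
Lemma LOCC_trans a b (M : 'M[R[i]]_(a, b)) c d (N : 'M[R[i]]_(c, d))
    e f (P : 'M[R[i]]_(e, f)) : LOCC N M -> LOCC P N -> LOCC P M.
Proof.
move=> MN NP; elim: MN => {a b M}; first by move=> z; apply: LOCC_scale.
- by move=> a b M c' d' A KA _ IH; apply: (LOCC_left KA).
- by move=> a b M c' d' B KB _ IH; apply: (LOCC_right KB).
Qed.

Lemma LOCC_refl a b (M : 'M[R[i]]_(a, b)) : LOCC M M.
Proof. by rewrite -{2}[M]scale1r; apply: LOCC_done. Qed.

(** A unitary is a measurement with a single outcome, so a change of both local bases takes one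
    round for each party. *)
Lemma LOCC_unitary n (U V M : 'M[R[i]]_n) :
  U \is unitarymx -> V \is unitarymx -> LOCC (U *m M *m V^T) M.
Proof.
have kraus1 (W : 'M[R[i]]_n) : W \is unitarymx ->
    kraus_complete (fun _ : 'I_1 => W).
  move=> /unitarymxP /mulmx1C WW.
  by rewrite /kraus_complete big_ord_recl big_ord0 addr0.
move=> /kraus1 KU /kraus1 KV; apply: (LOCC_left KU) => _.
by apply: (LOCC_right KV) => _; apply: LOCC_refl.
Qed.

Lemma LOCC_unitary_inv n (U V M : 'M[R[i]]_n) :
  U \is unitarymx -> V \is unitarymx -> LOCC M (U *m M *m V^T).
Proof.
move=> uU uV; have uU' := uU; rewrite -(trmxC_unitary U) in uU'.
have uV' := uV; rewrite -(trmxC_unitary V) in uV'.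
have := LOCC_unitary (U *m M *m V^T) uU' uV'; set N := (X in LOCC X _).
suff -> : N = M by [].
move: uU uV => /unitarymxP /mulmx1C UU /unitarymxP /mulmx1C VV.
rewrite /N !mulmxA UU mul1mx -mulmxA -trmx_mul.
by rewrite VV trmx1 mulmx1.
Qed.

Definition schmidt_mx d (x : nat -> R) : 'M[R[i]]_d :=
  diag_mx (\row_(j < d) (Num.sqrt (x j))%:C).

Lemma schmidt_mx_perm d (x y : nat -> R) (s : {perm 'I_d}) :
  (forall j : 'I_d, y j = x (s j)) ->
  perm_mx s *m schmidt_mx d x *m (perm_mx s)^T = schmidt_mx d y.
Proof.
move=> xy; rewrite tr_perm_mx -row_permE -col_permE; apply/matrixP => i j.
by rewrite !mxE -!xy (inj_eq perm_inj).
Qed.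

Lemma perm_mx_unitary d (s : {perm 'I_d}) : (perm_mx s : 'M[R[i]]_d) \is unitarymx.
Proof.
by apply/unitarymxP; rewrite tr_perm_mx map_perm_mx -perm_mxM fingroup.mulgV perm_mx1.
Qed.

Lemma LOCC_schmidt_perm d (x y : nat -> R) (s : {perm 'I_d}) :
  (forall j : 'I_d, y j = x (s j)) -> LOCC (schmidt_mx d y) (schmidt_mx d x).
Proof.
by move=> /schmidt_mx_perm <-; apply: LOCC_unitary; apply: perm_mx_unitary.
Qed.

(** The first party measures with diagonal operators whose entries are sqrt(t y_j / x_j) and sqrt((1
    - t) y_(s j) / x_j). The outcomes are multiples of the state of [y] and of a permuted copy of
    it, and local permutations undo the latter. *)
Lemma LOCC_convex d (x y : nat -> R) (s : {perm 'I_d}) t :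
  0 <= t <= 1 -> (forall j : 'I_d, 0 <= y j) ->
  (forall j : 'I_d, x j = t * y j + (1 - t) * y (s j)) ->
  LOCC (schmidt_mx d y) (schmidt_mx d x).
Proof.
move=> /andP[t0 t1] y0 xE; have t1' : 0 <= 1 - t by rewrite subr_ge0.
have x0 (j : 'I_d) : 0 <= x j by rewrite xE addr_ge0 ?mulr_ge0.
(* [w p u z] is sqrt(p u / z). At z = 0 the value sqrt(p) is chosen so that the squares of the two
   entries still add up to t + (1 - t) = 1 and the measurement stays complete. *)
pose w (p : R) (u : R) (z : R) := if z == 0 then Num.sqrt p else Num.sqrt (p * u / z).
have wM p u z : 0 <= p -> 0 <= u -> 0 <= z -> (z = 0 -> p * u = 0) ->
    w p u z * Num.sqrt z = Num.sqrt p * Num.sqrt u.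
  move=> p0 u0 z0 zu; rewrite /w; case: eqP => [z_eq0|/eqP zn].
    by rewrite z_eq0 sqrtr0 mulr0 -sqrtrM // zu ?sqrtr0.
  by rewrite -sqrtrM ?divr_ge0 ?mulr_ge0 // mulfVK // sqrtrM.
have w0 p u z : 0 <= w p u z by rewrite /w; case: ifP => _; rewrite sqrtr_ge0.
pose A (o : 'I_2) : 'M[R[i]]_d := diag_mx (\row_j
  (if o == 0 then w t (y j) (x j) else w (1 - t) (y (s j)) (x j))%:C).
have conjA o : map_mx Num.conj (A o)^T = A o.
  rewrite tr_diag_mx map_diag_mx; congr diag_mx; apply/rowP => j; rewrite !mxE.
  by apply: conj_Creal; apply: ger0_real; case: ifP => _; rewrite ler0c.
have AM o : A o *m schmidt_mx d x = diag_mx (\row_j (if o == 0 then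
     Num.sqrt t * Num.sqrt (y j) else Num.sqrt (1 - t) * Num.sqrt (y (s j)))%:C).
  rewrite /A /schmidt_mx mulmx_diag; congr diag_mx; apply/rowP => j.
  rewrite !mxE -rmorphM /=; congr (_ %:C).
  have [e1 e2] : (x j = 0 -> t * y j = 0) /\ (x j = 0 -> (1 - t) * y (s j) = 0).
    by have := xE j; have := mulr_ge0 t0 (y0 j);
       have := mulr_ge0 t1' (y0 (s j)) => ? ? ?; split => ?; lra.
  by case: ifP => _; rewrite wM.
apply: (@LOCC_left _ _ _ _ _ _ _ _ _ A).
  rewrite /kraus_complete !big_ord_recl big_ord0 addr0 !conjA /A !mulmx_diag /=.
  rewrite -raddfD /= -[1%:M]diag_const_mx; congr diag_mx; apply/rowP => j; rewrite !mxE /=.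
  rewrite -!rmorphM -rmorphD -(rmorph1 (real_complex R)) /=; congr (_ %:C).
  have [xj0|xjn] := eqVneq (x j) 0.
    by rewrite /w xj0 eqxx -!expr2 !sqr_sqrtr // addrC subrK.
  rewrite /w (negbTE xjn) -!expr2 !sqr_sqrtr ?divr_ge0 ?mulr_ge0 //.
  by rewrite -mulrDl -xE divff.
move=> o; case/orP: (orbN (o == 0)); move=> oE; rewrite AM.
  rewrite oE; have -> : diag_mx (\row_j (Num.sqrt t * Num.sqrt (y j))%:C) =
      (Num.sqrt t)%:C *: schmidt_mx d y.
    by rewrite -linearZ; congr diag_mx; apply/rowP => j; rewrite !mxE -rmorphM.
  exact: LOCC_done.
pose ys k := if insub k is Some j then y (s j) else 0.
have ysE (j : 'I_d) : ys j = y (s j) by rewrite /ys valK.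
rewrite (negbTE oE); have -> :
    diag_mx (\row_j (Num.sqrt (1 - t) * Num.sqrt (y (s j)))%:C) =
    (Num.sqrt (1 - t))%:C *: schmidt_mx d ys.
  by rewrite -linearZ; congr diag_mx; apply/rowP => j; rewrite !mxE -rmorphM ysE.
apply: LOCC_scale; apply: (@LOCC_schmidt_perm _ _ _ (fingroup.invg s)) => j.
by rewrite ysE permKV.
Qed.


Lemma ltr_sum_strict (I : finType) (P : pred I) (F G : I -> R) j :
  P j -> F j < G j -> (forall i, P i -> F i <= G i) ->
  \sum_(i | P i) F i < \sum_(i | P i) G i.
Proof.
move=> Pj FG le_FG; rewrite (bigD1 j) // [ltRHS](bigD1 j) //=.
by apply: ltr_leD => //; apply: ler_sum => i /andP[/le_FG].
Qed.

Lemma exists_lt_of_sum_le (u v : nat -> R) b i :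
  (i < b)%N -> v i < u i ->
  \sum_(0 <= i < b) u i <= \sum_(0 <= i < b) v i ->
  exists2 j, (j < b)%N & u j < v j.
Proof.
move=> ib vu; have [/existsP[j uvj] _|] := boolP [exists j : 'I_b, u j < v j].
  by exists j.
rewrite !big_mkord negb_exists leNgt => /forallP no; case/negP.
apply: (ltr_sum_strict (j := Ordinal ib)) => // j _.
by rewrite leNgt.
Qed.

(* The T-transform of Hardy, Littlewood and Polya: moving mass [e] from
   coordinate [j] to [k] makes [y] agree with [x] in one more coordinate. *)
Lemma LOCC_majorized d (x y : nat -> R) :
  (forall i j, (i <= j < d)%N -> x j <= x i) ->
  (forall i j, (i <= j < d)%N -> y j <= y i) ->
  (forall j, (j < d)%N -> 0 <= y j) ->
  (forall l, (l <= d)%N -> \sum_(0 <= i < l) x i <= \sum_(0 <= i < l) y i) ->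
  \sum_(0 <= i < d) x i = \sum_(0 <= i < d) y i ->
  LOCC (schmidt_mx d y) (schmidt_mx d x).
Proof.
move=> x_decr; have [m] := ubnP #|[set i : 'I_d | x i != y i]|.
elim: m y => // m IH y ym y_decr y0 xy xy_eq.
have [/forallP xyE|] := boolP [forall i : 'I_d, x i == y i].
  suff -> : schmidt_mx d x = schmidt_mx d y by apply: LOCC_refl.
  by congr diag_mx; apply/rowP => j; rewrite !mxE (eqP (xyE j)).
rewrite negb_forall => /existsP[i0 xyi0].
have ex_k : exists k, (k < d)%N && (y k < x k).
  have [xy0|] := ltP (x i0) (y i0); last first.
    by rewrite le_eqVlt eq_sym (negbTE xyi0) => ?; exists i0; rewrite ltn_ord.
  have [|||k kd yx] := @exists_lt_of_sum_le y x d i0 => //; first by rewrite xy_eq.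
  by exists k; rewrite kd.
(* [k] is the first index where [x] exceeds [y]. The prefix sums up to [k] then force an earlier
   index where [y] exceeds [x]; [j] is the last of these, so [x] and [y] agree strictly between [j]
   and [k]. *)
case: (ex_minnP ex_k) => k /andP[kd yxk] k_min.
have ex_j : exists j, (j < k)%N && (x j < y j).
  have [|||j jk xyj] := @exists_lt_of_sum_le x y k.+1 k => //; first exact: xy.
  exists j; rewrite xyj andbT ltn_neqAle -ltnS jk andbT.
  by apply/eqP => jkE; rewrite jkE ltNge (ltW yxk) in xyj.
case: (@ex_maxnP _ k ex_j) => [j /andP[/ltnW]//|j /andP[jk xyj] j_max].
have jd : (j < d)%N by apply: ltn_trans kd.
have xyE i : (j < i < k)%N -> x i = y i.
  move=> /andP[ji ik]; apply/eqP; rewrite eq_le; apply/andP; split; rewrite leNgt.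
    apply/negP => yx; have := k_min i; rewrite yx (ltn_trans ik kd) => /(_ isT).
    by rewrite leqNgt ik.
  apply/negP => yx; have := j_max i; rewrite yx ik => /(_ isT).
  by rewrite leqNgt ji.
(* The largest transfer that overshoots neither x_j nor x_k. It reaches one of them, so the number
   of disagreements with [x] decreases. *)
pose e := Num.min (y j - x j) (x k - y k).
have e0 : 0 < e by rewrite lt_min !subr_gt0 xyj.
have ej : e <= y j - x j by rewrite ge_min lexx.
have ek : e <= x k - y k by rewrite ge_min lexx orbT.
pose z i := if i == j then y j - e else if i == k then y k + e else y i.
have zj : z j = y j - e by rewrite /z eqxx.
have zk : z k = y k + e by rewrite /z eqxx (gtn_eqF jk).
have zi i : i != j -> i != k -> z i = y i by rewrite /z => /negbTE -> /negbTE ->.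
have xjk : x k <= x j by rewrite x_decr // (ltnW jk).
(* At [j] the new value is still at least x_j, at [k] at most x_k, and in between [z] coincides with
   [x]; so monotonicity is inherited from [x] and [y]. *)
have z_decr a b : (a <= b < d)%N -> z b <= z a.
  move=> /andP[ab bd]; have [->//|nab] := eqVneq a b.
  have {nab}ab : (a < b)%N by rewrite ltn_neqAle nab.
  have yab : y b <= y a by rewrite y_decr // (ltnW ab).
  have xab : x b <= x a by rewrite x_decr // (ltnW ab).
  have [aj|naj] := eqVneq a j; have [bk|nbk] := eqVneq b k.
  - by rewrite aj bk zj zk; lra.
  - subst a; have nbj : b != j by rewrite (gtn_eqF ab).
    rewrite zj (zi b) //; have [bk|bk] := ltnP b k; first by rewrite -(xyE b) ?ab //; lra.
    have : y b <= y k by rewrite y_decr // bk.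
    by lra.
  - subst b; have nak : a != k by rewrite (ltn_eqF ab).
    rewrite zk (zi a) //; have [ja|aj] := ltnP j a; first by rewrite -(xyE a) ?ja //; lra.
    have : y j <= y a by rewrite y_decr // aj jd.
    by lra.
  - have [ak|nak] := eqVneq a k.
      by subst a; rewrite zk zi ?(gtn_eqF (ltn_trans jk ab)) //; lra.
    rewrite (zi a) //; have [bj|nbj] := eqVneq b j; last by rewrite zi.
    by rewrite bj zj -bj; lra.
have sum_z l : \sum_(0 <= i < l) z i =
    \sum_(0 <= i < l) y i - (if (j < l)%N then e else 0) + (if (k < l)%N then e else 0).
  elim: l => [|l IHl]; first by rewrite !big_nil !ltn0 subr0 addr0.
  rewrite !big_nat_recr //= IHl !ltnS; have [lj|lj|lj] := ltngtP j l.
  - have [lk|lk|lk] := ltngtP k l; last by rewrite -lk zk /=; lra.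
      by rewrite zi ?(gtn_eqF lj) ?(gtn_eqF lk) //=; lra.
    by rewrite zi ?(gtn_eqF lj) ?(ltn_eqF lk) //=; lra.
  - by rewrite (ltn_geF (ltn_trans lj jk)) (ltnNge k) (ltnW (ltn_trans lj jk)) /=
       zi ?(ltn_eqF lj) ?(ltn_eqF (ltn_trans lj jk)) //=; lra.
  - by rewrite -lj (ltn_geF jk) (ltnNge k) (ltnW jk) /= zj; lra.
have xz l : (l <= d)%N -> \sum_(0 <= i < l) x i <= \sum_(0 <= i < l) z i.
  move=> ld; rewrite sum_z; have [jl|lj] := ltnP j l; last first.
    by rewrite ltnNge (leq_trans lj (ltnW jk)) /=; have := xy l ld; lra.
  have [kl|] := ltnP k l; first by have := xy l ld; lra.
  (* Prefixes ending between [j] and [k] lose [e]. The surplus y_j - x_j pays for it, and the later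
     terms of the prefix coincide with those of [x]. *)
  elim: l ld jl => // l IHl ld; rewrite ltnS leq_eqVlt => /orP[/eqP<-{l IHl ld}|jl] lk.
    by rewrite !big_nat_recr //=; have := xy j (ltnW jd); lra.
  rewrite !big_nat_recr //= (xyE l) ?jl //.
  by have := IHl (ltnW ld) jl (ltnW lk); lra.
have xz_eq : \sum_(0 <= i < d) x i = \sum_(0 <= i < d) z i.
  by rewrite sum_z jd kd xy_eq; lra.
have z0 i : (i < d)%N -> 0 <= z i.
  move=> id; have := y0 i id; have := y0 k kd; rewrite /z => ? ?.
  by case: ifP => [|_]; [|case: ifP]; move=> *; lra.
have yjk : 0 < y j - y k by lra.
apply: (@LOCC_trans _ _ _ _ _ (schmidt_mx d z)).
  apply: IH => //; rewrite ltnS in ym; apply: leq_trans ym; apply: proper_card.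
  apply/properP; split.
    apply/subsetP => i; rewrite !inE; apply: contra => /eqP xyi; rewrite zi ?xyi //.
      by apply: contraTneq xyj => <-; rewrite xyi ltxx.
    by apply: contraTneq yxk => <-; rewrite xyi ltxx.
  have [eE|eE] : e = y j - x j \/ e = x k - y k.
    by rewrite /e; case: leP => _; [left|right].
    exists (Ordinal jd); rewrite !inE /=; first by rewrite (lt_eqF xyj).
    by rewrite zj eE subKr eqxx.
  exists (Ordinal kd); rewrite !inE /=; first by rewrite (gt_eqF yxk).
  by rewrite zk eE addrC subrK eqxx.
pose s := tperm (Ordinal jd) (Ordinal kd).
(* With this weight, [z] is the mixture of [y] and of [y] with the entries [j] and [k] exchanged. *)
apply: (@LOCC_convex _ _ _ s (1 - e / (y j - y k))).
- rewrite subr_ge0 ler_pdivrMr // mul1r gerBl divr_ge0 ?ltW //=; lra.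
- by move=> i; apply: y0.
- move=> i; rewrite subKr /s; case: tpermP => [->|->|ij ik] /=.
  + by rewrite zj; field; rewrite gt_eqF.
  + by rewrite zk; field; rewrite gt_eqF.
  + rewrite zi; first by field; rewrite gt_eqF.
      by apply/eqP => iE; apply: ij; apply: val_inj.
    by apply/eqP => iE; apply: ik; apply: val_inj.
Qed.

End Protocols.

(** * Sums of largest components *)

Section LargestSums.
Variable R : rcfType.
Implicit Types s : seq R.

Lemma decr_sorted s : sorted >=%R (decr s).
Proof. exact/sort_sorted/ge_total. Qed.

Lemma perm_decr s : perm_eq (decr s) s.
Proof. by rewrite /decr perm_sort. Qed.

Lemma decr_id s : sorted >=%R s -> decr s = s.
Proof. by move=> s_sorted; apply: sorted_sort => //; exact: ge_trans. Qed.

Lemma nth_sorted s i j : sorted >=%R s -> (i <= j < size s)%N -> s`_j <= s`_i.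
Proof.
move=> s_sorted /andP[ij js]; have is_lt := leq_ltn_trans ij js.
exact: (sorted_leq_nth ge_trans (@lexx _ R) 0 s_sorted).
Qed.

Lemma e_sum_sorted l s : sorted >=%R s -> (l <= size s)%N ->
  e_sum l s = \sum_(0 <= i < l) s`_i.
Proof.
move=> s_sorted ls; rewrite /e_sum decr_id // (big_nth 0) size_takel //; apply: eq_big_nat => i /andP[_ il].
by rewrite nth_take.
Qed.

Lemma e_sum_decr l s : e_sum l (decr s) = e_sum l s.
Proof. by rewrite /e_sum decr_id // decr_sorted. Qed.

Lemma e_sum_full s : e_sum (size s) s = vsum s.
Proof.
rewrite /e_sum take_oversize ?size_sort //; apply: perm_big; exact: perm_decr.
Qed.

(** The i-th entry of a subsequence sits at position at least i in [s], so it is at most the i-th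
    entry of a non-increasing [s]. *)
Lemma sum_subseq_le s' s : sorted >=%R s -> subseq s' s ->
  \sum_(a <- s') a <= \sum_(a <- take (size s') s) a.
Proof.
elim: s s' => [|x s IH] [|y s'] //=.
move=> xs; have s_sorted := path_sorted xs; rewrite !big_cons.
case: eqP => [-> /IH -/(_ s_sorted)|_ sub]; first by rewrite lerD2l.
have /allP/(_ y) := order_path_min ge_trans xs.
rewrite (mem_subseq sub) ?mem_head // => /(_ isT) yx.
by rewrite lerD // IH // (subseq_trans _ sub) // subseq_cons.
Qed.

Section Selections.
Variables (T : finType) (f : T -> R) (s : seq R).
Hypothesis sf : perm_eq s [seq f t | t <- enum T].

Let L := sort (relpre f >=%R) (enum T).

Let decrE : decr s = [seq f t | t <- L].
Proof.
rewrite /L -sort_map; apply/perm_sortP => //.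
- exact: ge_total.
- exact: ge_trans.
- exact: ge_anti.
Qed.

Let L_uniq : uniq L. Proof. by rewrite sort_uniq enum_uniq. Qed.

Let memL t : t \in L. Proof. by rewrite mem_sort mem_enum. Qed.

(** Listed in decreasing order of [f], the elements of [A] give a subsequence of [decr s]. Together
    with [e_sum_attained], this makes [e_sum l s] the maximum of the sums over sets of [l]
    indices. *)
Lemma sum_le_e_sum (A : {set T}) : \sum_(t in A) f t <= e_sum #|A| s.
Proof.
pose A' := [seq t <- L | t \in A].
have A'_uniq : uniq A' by rewrite filter_uniq.
have sumA : \sum_(t in A) f t = \sum_(a <- [seq f t | t <- A']) a.
  rewrite big_map big_uniq //=; apply: eq_bigl => t.
  by rewrite mem_filter memL andbT.
have cardA : #|A| = size [seq f t | t <- A'].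
  rewrite size_map -(card_uniqP A'_uniq); apply: eq_card => t.
  by rewrite mem_filter memL andbT.
rewrite sumA cardA; apply: sum_subseq_le; first exact: decr_sorted.
by rewrite decrE map_subseq // filter_subseq.
Qed.

Lemma e_sum_attained l : (l <= #|T|)%N ->
  exists2 A : {set T}, #|A| = l & \sum_(t in A) f t = e_sum l s.
Proof.
move=> lT; exists [set t in take l L].
  rewrite cardsE (card_uniqP (take_uniq _ L_uniq)) size_takel //.
  by rewrite size_sort -cardE.
rewrite /e_sum decrE -map_take big_map big_uniq ?take_uniq //=.
by apply: eq_bigl => t; rewrite inE.
Qed.

End Selections.

Lemma perm_nth_enum s n : size s = n -> perm_eq s [seq s`_(i : 'I_n) | i <- enum 'I_n].
Proof.
move=> <-; rewrite -{1}[s](mkseq_nth 0) /mkseq -val_enum_ord -map_comp.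
exact: perm_refl.
Qed.

Lemma size_kron s s' : size (kron s s') = (size s * size s')%N.
Proof. by rewrite size_allpairs. Qed.

Lemma vsum_kron s s' : vsum (kron s s') = vsum s * vsum s'.
Proof.
rewrite /vsum; elim: s => [|a s IH] /=; first by rewrite !big_nil mul0r.
by rewrite big_cat big_map -mulr_sumr big_cons mulrDl -IH.
Qed.

Lemma nth_kron s s' i j : (i < size s)%N -> (j < size s')%N ->
  (kron s s')`_(i * size s' + j) = s`_i * s'`_j.
Proof.
elim: s i => //= a s IH [|i] ilt jlt; rewrite nth_cat size_map.
  by rewrite mul0n add0n jlt (nth_map 0).
rewrite mulSn -addnA ltnNge leq_addr /= addKn; exact: IH.
Qed.

(** The index of [s'] comes first in the pairs, so that a set of pairs splits into columns, one for
    each component of the auxiliary vector. *)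
Lemma perm_kron_enum s s' n k : size s = n -> size s' = k ->
  perm_eq (kron s s')
    [seq s`_(p.2 : 'I_n) * s'`_(p.1 : 'I_k) | p <- enum {: 'I_k * 'I_n}].
Proof.
move=> sn sk.
have -> : kron s s' = [seq s`_(p.2 : 'I_n) * s'`_(p.1 : 'I_k) |
            p <- [seq (j, i) | i <- enum 'I_n, j <- enum 'I_k]].
  rewrite map_allpairs /kron.
  rewrite -{1}[s](mkseq_nth 0) -{1}[s'](mkseq_nth 0) sn sk /mkseq.
  by rewrite allpairs_mapl allpairs_mapr -!val_enum_ord allpairs_mapl allpairs_mapr.
apply: perm_map; apply: uniq_perm; rewrite ?enum_uniq //.
  by apply: allpairs_uniq; rewrite ?enum_uniq // => -[? ?] [? ?] _ _ [-> ->].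
by move=> [j i]; rewrite mem_enum; apply/allpairsP; exists (i, j); rewrite !mem_enum.
Qed.

End LargestSums.

(** * From majorization to deterministic transformability *)

Section Nielsen.
Variable R : rcfType.

Lemma tensmx1 n k : 1%:M *t 1%:M = 1%:M :> 'M[R[i]]_(n * k).
Proof.
apply/matrixP => i j; rewrite -(mxtens_unindexK i) -(mxtens_unindexK j) tensmxE !mxE.
by rewrite (inj_eq (can_inj (@mxtens_indexK n k))) -natrM mulnb -xpair_eqE.
Qed.

Lemma tensmx_unitary n k (A : 'M[R[i]]_n) (B : 'M[R[i]]_k) :
  A \is unitarymx -> B \is unitarymx -> A *t B \is unitarymx.
Proof.
move=> /unitarymxP AA /unitarymxP BB; apply/unitarymxP.
by rewrite trmx_tens map_mxT tensmx_mul AA BB tensmx1.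
Qed.

(** The Schmidt bases of a product are the tensor products of the Schmidt bases. The pair of indices
    i and i' is numbered i * k + i', which is where [kron] puts the product of psi_i and chi_i'. *)
Lemma tensmx_state n k (M : 'M[R[i]]_n) (C : 'M[R[i]]_k) psi chi :
  state_with_schmidt M psi -> state_with_schmidt C chi ->
  exists U V : 'M[R[i]]_(n * k), [/\ U \is unitarymx, V \is unitarymx
    & M *t C = U *m schmidt_mx (n * k) (nth 0 (kron psi chi)) *m V^T].
Proof.
move=> [_ /all_tnthP psi0 _ [U [V [uU uV ->]]]] [_ _ _ [U' [V' [uU' uV' ->]]]].
exists (U *t U'), (V *t V'); split; try exact: tensmx_unitary.
rewrite trmx_tens -!tensmx_mul; congr (_ *m _ *m _).
apply/matrixP => i j; case: (mxtens_indexP i) => {i} i i'.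
case: (mxtens_indexP j) => {j} j j'; rewrite tensmxE !mxE.
rewrite (inj_eq (can_inj (@mxtens_indexK n k))) xpair_eqE.
have := @nth_kron R psi chi i i'; rewrite !size_tuple => -> //.
rewrite sqrtrM; last by rewrite -tnth_nth psi0.
rewrite rmorphM !(tnth_nth 0) /=.
by case: eqP => _; case: eqP => _; rewrite ?mulr1n ?mulr0n ?mulr0 ?mul0r.
Qed.

Lemma LOCC_perm_eq d (s t : seq R) : size s = d -> perm_eq s t ->
  LOCC (schmidt_mx d (nth 0 t)) (schmidt_mx d (nth 0 s)).
Proof.
move=> sd; rewrite perm_sym => ts; have td : size t == d by rewrite (perm_size ts) sd.
have /tuple_permP[p /= tE] : perm_eq (Tuple td) (Tuple (introT eqP sd)) by [].
apply: (@LOCC_schmidt_perm _ _ _ _ p) => j.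
by rewrite tE (nth_map j) ?size_enum_ord // nth_ord_enum (tnth_nth 0).
Qed.

(** Local unitaries remove the Schmidt bases of the source and restore those of the target,
    permutations sort both coefficient vectors, and [LOCC_majorized] connects the sorted vectors. *)
Lemma majorized_transforms n k (M N : 'M[R[i]]_n) (C O : 'M[R[i]]_k)
    (psi phi : n.-tuple R) (chi omega : k.-tuple R) :
  state_with_schmidt M psi -> state_with_schmidt C chi ->
  state_with_schmidt N phi -> state_with_schmidt O omega ->
  majorized (kron psi chi) (kron phi omega) -> transforms (M *t C) (N *t O).
Proof.
move=> Mpsi Cchi Nphi Oomega [szE maj maj_full].
have [U [V [uU uV ->]]] := tensmx_state Mpsi Cchi.
have [U' [V' [uU' uV' ->]]] := tensmx_state Nphi Oomega.
have phi_omega0 : all (fun a => 0 <= a) (kron phi omega).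
  case: Nphi Oomega => _ /allP phi0 _ _ [_ /allP omega0 _ _].
  by apply/allP => _ /allpairsP[[a b] [/phi0 ? /omega0 ? ->]]; rewrite mulr_ge0.
have psi_chi_size : size (kron psi chi) = (n * k)%N by rewrite size_kron !size_tuple.
set x := kron psi chi in szE maj maj_full psi_chi_size *.
set y := kron phi omega in szE maj maj_full phi_omega0 *.
have y_size : size y = (n * k)%N by rewrite -szE.
have dx : size (decr x) = (n * k)%N by rewrite size_sort.
have dy : size (decr y) = (n * k)%N by rewrite size_sort.
apply: (LOCC_trans (LOCC_unitary_inv _ uU uV)).
apply: (LOCC_trans _ (LOCC_unitary _ uU' uV')).
apply: LOCC_trans (LOCC_perm_eq psi_chi_size _) _; first by rewrite perm_sym; exact: perm_decr.
apply: LOCC_trans _ (LOCC_perm_eq dy (perm_decr y)).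
have sum_decr (s : seq R) l : size s = (n * k)%N -> (l <= n * k)%N ->
    \sum_(0 <= i < l) (decr s)`_i = e_sum l s.
  by move=> ss lnk; rewrite -e_sum_decr e_sum_sorted ?decr_sorted ?size_sort ?ss.
apply: LOCC_majorized.
- by move=> i j ijd; apply: nth_sorted; rewrite ?decr_sorted ?dx.
- by move=> i j ijd; apply: nth_sorted; rewrite ?decr_sorted ?dy.
- by move=> j jd; apply/(allP phi_omega0); rewrite -(mem_sort >=%R) mem_nth ?dy.
- move=> l lnk; rewrite !sum_decr //; case: l lnk => [|l] lnk.
    by rewrite /e_sum !take0.
  have [->|ne] := eqVneq l.+1 (size x); first by rewrite maj_full.
  by apply: maj; rewrite psi_chi_size; lia.
- by rewrite !sum_decr // -{1}psi_chi_size maj_full psi_chi_size.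
Qed.

End Nielsen.

(** * Uniformity indices *)

Section Uniformity.
Variable R : rcfType.
Implicit Types (s t : seq R) (P : pred R).

Lemma mem_distinct s : distinct s =i s.
Proof. by move=> a; rewrite mem_sort mem_undup. Qed.

(** As g < 1, every entry satisfying [P] exceeds every entry that does not. At the last distinct
    value satisfying [P], the ratio of the next distinct value to it is one of those whose minimum
    is [l_u s], and it is at most [g]. *)
Lemma l_u_gap s P g x y :
  (forall a, a \in s -> 0 < a) -> g < 1 ->
  x \in s -> P x -> y \in s -> ~~ P y ->
  (forall u v, u \in s -> v \in s -> P u -> ~~ P v -> v <= g * u) ->
  l_u s <= g.
Proof.
move=> s0 g1 xs Px ys Py gap; have t_sorted := decr_sorted (undup s).
rewrite -/(distinct s) in t_sorted; set t := distinct s in t_sorted.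
have ts a : (a \in t) = (a \in s) by rewrite mem_distinct.
have lt_gap u v : u \in s -> v \in s -> P u -> ~~ P v -> v < u.
  by move=> us vs Pu Pv; apply: le_lt_trans (gap u v us vs Pu Pv) _; rewrite gtr_pMl ?s0.
have [i [it Pi Pi1]] : exists i, [/\ (i.+1 < size t)%N, P t`_i & ~~ P t`_i.+1].
  have ex : exists i, (i < size t)%N && P t`_i.
    by exists (index x t); rewrite index_mem nth_index ?ts // xs.
  have bound i : (i < size t)%N && P t`_i -> (i <= size t)%N by case/andP => /ltnW.
  case: (ex_maxnP ex bound) => i /andP[it Pi] i_max.
  have iy : (i < index y t)%N.
    rewrite ltnNge; apply/negP => yi.
    have := nth_sorted t_sorted (i := index y t) (j := i); rewrite yi it => /(_ isT).
    by rewrite nth_index ?ts // leNgt lt_gap // -ts mem_nth.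
  have i1t : (i.+1 < size t)%N by apply: leq_ltn_trans iy _; rewrite index_mem ts.
  exists i; split => //.
  by apply/negP => Pi1; have := i_max i.+1; rewrite i1t Pi1 ltnn => /(_ isT).
have tis : t`_i \in s by rewrite -ts mem_nth // ltnW.
have ti1s : t`_i.+1 \in s by rewrite -ts mem_nth.
have it' : (i < (size t).-1)%N by rewrite ltn_predRL.
apply: (@le_trans _ _ (t`_i.+1 / t`_i)).
  exact: (bigmin_le_cond _ (fun i : 'I_(size t).-1 => t`_i.+1 / t`_i) (j := Ordinal it')).
by rewrite ler_pdivrMr ?s0 // gap.
Qed.

Lemma le_nth0 s a : sorted >=%R s -> a \in s -> a <= s`_0.
Proof. by move=> s_sorted /(nthP 0)[i i_s <-]; rewrite nth_sorted. Qed.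

Lemma ge_nth_last s a : sorted >=%R s -> a \in s -> s`_(size s).-1 <= a.
Proof.
move=> s_sorted /(nthP 0)[i i_s <-]; rewrite nth_sorted //.
by rewrite -ltnS prednK ?leqnn ?andbT // (leq_ltn_trans _ i_s).
Qed.

Lemma g_u_ends s : sorted >=%R s -> s`_(size s).-1 < s`_0 ->
  g_u s = s`_(size s).-1 / s`_0.
Proof.
move=> s_sorted s_lt; have s_gt0 : (0 < size s)%N.
  by case: (s) s_lt; rewrite ?ltxx.
have t_sorted := decr_sorted (undup s); rewrite -/(distinct s) in t_sorted.
have ts := mem_distinct s; rewrite /g_u; set t := distinct s in t_sorted ts *.
have s0t : s`_0 \in t by rewrite ts mem_nth.
have s1t : s`_(size s).-1 \in t by rewrite ts mem_nth // prednK.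
have t_gt1 : (1 < size t)%N.
  case: (t) s0t s1t => [|a [|b t']] //; rewrite !inE => /eqP s0 /eqP s1.
  by rewrite s0 s1 ltxx in s_lt.
have t_gt0 : (0 < size t)%N by apply: ltnW.
have t0s : t`_0 \in s by rewrite -ts mem_nth.
have t1s : t`_(size t).-1 \in s by rewrite -ts mem_nth // prednK.
rewrite t_gt1 -nth_last -nth0; congr (_ / _); apply/eqP; rewrite eq_le.
  by rewrite !ge_nth_last.
by rewrite !le_nth0.
Qed.

End Uniformity.

(** * Consecutive blocks *)

Section Flatten.
Variables (R : rcfType) (ss : seq (seq R)).

(** The position of the first component of block [q] in the concatenation. Blocks count from 0 here,
    whereas [block] counts them from 1. *)
Definition start (ss : seq (seq R)) (q : nat) : nat := sumn (take q (shape ss)).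

Lemma start0 : start ss 0 = 0%N. Proof. by rewrite /start take0. Qed.

Lemma startS q : start ss q.+1 = (start ss q + size (nth [::] ss q))%N.
Proof.
rewrite /start; have [qs|sq] := ltnP q (size ss).
  by rewrite (take_nth 0%N) ?size_map // sumn_rcons (nth_map [::]).
by rewrite !take_oversize ?size_map ?nth_default ?addn0 // ltnW.
Qed.

Lemma start_size : start ss (size ss) = size (flatten ss).
Proof. by rewrite /start take_oversize ?size_map // size_flatten. Qed.

Lemma leq_start p q : (p <= q)%N -> (start ss p <= start ss q)%N.
Proof.
move=> /subnK <-; elim: (q - p)%N => // d IH.
by rewrite addSn startS (leq_trans IH) // leq_addr.
Qed.

Lemma nth_flatten_start q r : (r < size (nth [::] ss q))%N ->
  (flatten ss)`_(start ss q + r) = (nth [::] ss q)`_r.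
Proof.
rewrite /start; elim: ss q => [|s ss' IH] [|q] //= rs; rewrite nth_cat.
  by rewrite add0n rs.
by rewrite -addnA ltnNge leq_addr /= addKn IH.
Qed.

Lemma start_ltn q r : (r < size (nth [::] ss q))%N ->
  (start ss q + r < size (flatten ss))%N.
Proof.
move=> rs; have qs : (q < size ss)%N.
  by rewrite ltnNge; apply/negP => sq; rewrite nth_default in rs.
by rewrite -start_size (leq_trans _ (leq_start qs)) // startS ltn_add2l.
Qed.

Lemma mem_block_pos q a : a \in nth [::] ss q ->
  exists2 c, (start ss q <= c < start ss q.+1)%N & (flatten ss)`_c = a.
Proof.
move=> /(nthP 0)[r rs <-]; exists (start ss q + r)%N; last exact: nth_flatten_start.
by rewrite leq_addr startS ltn_add2l.
Qed.

Lemma pos_mem_block q c : (start ss q <= c < start ss q.+1)%N ->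
  (flatten ss)`_c \in nth [::] ss q.
Proof.
rewrite startS => /andP[qc cq]; rewrite -(subnKC qc) nth_flatten_start.
  by rewrite mem_nth // ltn_subLR.
by rewrite ltn_subLR.
Qed.

Lemma pos_ltn_size q c : (q < size ss)%N -> (c < start ss q.+1)%N ->
  (c < size (flatten ss))%N.
Proof. by move=> qs /leq_trans; apply; rewrite -start_size leq_start. Qed.

Lemma pos_block c : (c < size (flatten ss))%N ->
  exists2 q, (q < size ss)%N & (start ss q <= c < start ss q.+1)%N.
Proof.
rewrite -start_size; elim: (size ss) => [|q IH]; first by rewrite start0.
have [cq _|qc cq] := ltnP c (start ss q).
  by have [p pq ?] := IH cq; exists p => //; apply: leqW.
by exists q; rewrite ?qc.
Qed.

Lemma sum_blocks (F : nat -> R) b :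
  \sum_(0 <= c < start ss b) F c =
  \sum_(0 <= q < b) \sum_(start ss q <= c < start ss q.+1) F c.
Proof.
elim: b => [|b IH]; first by rewrite start0 !big_nil.
by rewrite big_nat_recr //= -IH -big_cat_nat // leq_start.
Qed.

Lemma sum_in_block q l : (l <= size (nth [::] ss q))%N ->
  \sum_(start ss q <= c < start ss q + l) (flatten ss)`_c =
  \sum_(0 <= r < l) (nth [::] ss q)`_r.
Proof.
move=> ls; rewrite -{1}[start ss q]add0n big_addn addKn.
apply: eq_big_nat => r /andP[_ rl]; rewrite addnC nth_flatten_start //.
exact: leq_trans rl ls.
Qed.

Lemma sum_block q :
  \sum_(start ss q <= c < start ss q.+1) (flatten ss)`_c = vsum (nth [::] ss q).
Proof. by rewrite startS sum_in_block // /vsum [RHS](big_nth 0). Qed.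

Lemma sorted_block q : sorted >=%R (flatten ss) -> sorted >=%R (nth [::] ss q).
Proof.
have [qs|sq _] := ltnP q (size ss); last by rewrite nth_default.
apply: subseq_sorted; first exact: ge_trans.
rewrite -{2}(cat_take_drop q ss) (drop_nth [::]) // flatten_cat /=.
by apply: subseq_trans (suffix_subseq _ _); apply: prefix_subseq.
Qed.

End Flatten.

(** * Grouped indices *)

Section Groups.
Variables (R : rcfType) (xs ys : seq (seq R)).

Let I := I_set xs ys.
Let m := size xs.
Let k j := k_ xs ys j.
Let p := size I.

Lemma mem_I_set i : (i \in I) = (block xs i == block ys i) && (1 <= i <= m)%N.
Proof. by rewrite mem_filter mem_iota add1n ltnS. Qed.

Lemma mem_D_set i : (i \in D_set xs ys) = (block xs i != block ys i) && (1 <= i <= m)%N.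
Proof. by rewrite mem_filter mem_iota add1n ltnS. Qed.

Lemma k_ltn a b : (a < b <= p.+1)%N -> (k a < k b)%N.
Proof.
move=> /andP[ab bp].
have K_sorted : sorted ltn (0%N :: rcons I m.+1).
  rewrite /= rcons_path; apply/andP; split.
    rewrite (path_sortedE ltn_trans) sorted_filter ?iota_ltn_sorted ?andbT //; last exact: ltn_trans.
    by apply/allP => i; rewrite mem_I_set => /andP[_ /andP[]].
  have : last 0%N I \in 0%N :: I by apply: mem_last.
  by rewrite inE mem_I_set => /orP[/eqP->|/andP[_ /andP[]]] //.
by apply: (sorted_ltn_nth ltn_trans 0%N K_sorted) => //;
  rewrite unfold_in /= size_rcons ltnS // ltnW // (leq_trans ab).
Qed.

Lemma k_leq a b : (a <= b <= p.+1)%N -> (k a <= k b)%N.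
Proof.
rewrite leq_eqVlt => /andP[/orP[/eqP->//|ab] bp].
by apply/ltnW/k_ltn; rewrite ab.
Qed.

Lemma k_in_I j : (0 < j <= p)%N -> k j \in I.
Proof. by case: j => // j /= jp; rewrite /k /k_ /= nth_rcons -/I -/p jp mem_nth. Qed.

Lemma I_is_k i : i \in I -> exists2 j, (0 < j <= p)%N & i = k j.
Proof.
move=> iI; exists (index i I).+1; rewrite /= ?index_mem //.
by rewrite /k /k_ /= nth_rcons index_mem iI nth_index.
Qed.

Lemma mem_D_ j s : (s \in D_ xs ys j) = (k j < s < k j.+1)%N && (1 <= s <= m)%N.
Proof.
rewrite mem_filter mem_iota add1n ltnS addn1 -/(k j) -/(k j.+1).
by apply/idP/idP; lia.
Qed.

Lemma D_grpP J : reflect (exists j, [/\ (j <= p)%N, J = D_ xs ys j & J != [::]])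
  (J \in D_grp xs ys).
Proof.
rewrite mem_filter; apply: (iffP andP) => [[J0 /mapP[j]]|[j [jp -> ->]]].
  by rewrite mem_iota add0n ltnS => jp JE; exists j; rewrite -JE.
by split=> //; apply: map_f; rewrite mem_iota add0n ltnS.
Qed.

(** A group fills the gap between two consecutive unchanged indices, so no unchanged index separates
    its elements. *)
Lemma D_grp_side J i : J \in D_grp xs ys -> i \in I ->
  (forall s, s \in J -> i < s)%N \/ (forall s, s \in J -> s < i)%N.
Proof.
move=> /D_grpP[j [jp -> _]] /I_is_k[a /andP[a0 ap] ->].
have [aj|ja] := leqP a j; [left|right] => s; rewrite mem_D_ => /andP[/andP[js sj] _].
  by apply: leq_ltn_trans js; apply: k_leq; rewrite aj leqW.
by apply: leq_trans sj _; apply: k_leq; rewrite ja leqW.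
Qed.

Lemma D_grp_D_set J s : J \in D_grp xs ys -> s \in J -> s \in D_set xs ys.
Proof.
move=> JD sJ; have sm : (1 <= s <= m)%N.
  by case/D_grpP: JD sJ => j [_ -> _]; rewrite mem_D_ => /andP[].
rewrite mem_D_set sm andbT; apply/negP => sE.
have /(D_grp_side JD)[/(_ s sJ)|/(_ s sJ)] : s \in I by rewrite mem_I_set sE.
  by rewrite ltnn.
by rewrite ltnn.
Qed.

Lemma max_idx_in J : J != [::] -> max_idx J \in J.
Proof.
rewrite /max_idx; elim: J => // a [|b J] IH _; first by rewrite big_seq1 mem_head.
rewrite big_cons maxnE inE -maxnE /maxn; case: ifP => _; last by rewrite eqxx.
by rewrite IH // orbT.
Qed.

Lemma leq_max_idx J s : s \in J -> (s <= max_idx J)%N.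
Proof. by move=> sJ; apply: (leq_bigmax_seq (F := id)). Qed.

Lemma min_idx_in J : J != [::] -> min_idx J \in J.
Proof.
move=> /max_idx_in; rewrite /min_idx.
suff bigmin_in d K : \big[minn/d]_(j <- K) j \in d :: K.
  by move=> maxJ; have := bigmin_in (max_idx J) J; rewrite inE => /orP[/eqP->|].
elim: K => [|a K]; first by rewrite big_nil mem_head.
rewrite big_cons !inE /minn; case: ifP => _; first by rewrite eqxx orbT.
by case/orP => ->; rewrite ?orbT.
Qed.

Lemma geq_min_idx J s : s \in J -> (min_idx J <= s)%N.
Proof.
rewrite /min_idx; move: (max_idx J) => d.
elim: J => // a J IH; rewrite inE big_cons => /orP[/eqP->|/IH]; first exact: geq_minl.
by apply: leq_trans; apply: geq_minr.
Qed.

(** Since [J] lies on one side of [i], its nearest element is its first or its last one. This is how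
    the embedding condition meets the condition on the blocks at the ends of [J]. *)
Lemma nearest_end J i : J \in D_grp xs ys -> i \in I ->
  exists2 j, j \in [:: max_idx J; min_idx J] & nearest i J j.
Proof.
move=> JD iI; have J0 : J != [::] by case/D_grpP: (JD) => j [].
have [J_gt|J_lt] := D_grp_side JD iI.
  exists (min_idx J); rewrite ?inE ?eqxx ?orbT // /nearest min_idx_in //=.
  apply/allP => s sJ; have := J_gt _ (min_idx_in J0); have := geq_min_idx sJ.
  by have := J_gt _ sJ; lia.
exists (max_idx J); rewrite ?inE ?eqxx ?orbT // /nearest max_idx_in //=.
apply/allP => s sJ; have := J_lt _ (max_idx_in J0); have := leq_max_idx sJ.
by have := J_lt _ sJ; lia.
Qed.

Lemma mem_groups G : G \in groups xs ys = (G \in I_grp xs ys) || (G \in D_grp xs ys).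
Proof.
apply/idP/idP.
  rewrite mem_filter inE => /andP[G0 /orP[/eqP GE|/flattenP[? /mapP[j]]]].
    by apply/orP; right; apply/D_grpP; exists 0%N.
  rewrite mem_iota add1n ltnS => jp ->; rewrite !inE => /orP[/eqP->|/eqP GE].
    by apply/orP; left; apply: map_f; apply: k_in_I.
  by apply/orP; right; apply/D_grpP; exists j; case/andP: jp.
case/orP => [/mapP[i /I_is_k[j jp ->] ->]|/D_grpP[j [jp -> D0]]]; rewrite mem_filter.
  apply/andP; split=> //; rewrite inE; apply/orP; right; apply/flattenP.
  exists [:: [:: k j]; D_ xs ys j]; last by rewrite inE eqxx.
  by apply/mapP; exists j => //; rewrite mem_iota add1n ltnS.
rewrite D0 inE; case: j jp {D0} => [|j] jp; first by rewrite eqxx.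
apply/orP; right; apply/flattenP; exists [:: [:: k j.+1]; D_ xs ys j.+1].
  by apply/mapP; exists j.+1 => //; rewrite mem_iota add1n ltnS.
by rewrite !inE eqxx orbT.
Qed.

Lemma D_inj a b : (a <= p)%N -> (b <= p)%N -> D_ xs ys a != [::] ->
  D_ xs ys a = D_ xs ys b -> a = b.
Proof.
move=> ap bp a0 ab; case: (D_ xs ys a) a0 (mem_D_ a) ab => // s S _ mem_a ab.
have sa : s \in s :: S by apply: mem_head.
have sb := sa; rewrite ab in sb; rewrite mem_a in sa; rewrite mem_D_ in sb.
case/andP: sa => /andP[as1 as2] _; case/andP: sb => /andP[bs1 bs2] _.
have [lt_ab|lt_ba|//] := ltngtP a b.
  have := @k_leq a.+1 b; rewrite lt_ab leqW // => /(_ isT).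
  by move=> kab; have := ltn_trans bs1 as2; rewrite ltnNge kab.
have := @k_leq b.+1 a; rewrite lt_ba leqW // => /(_ isT).
by move=> kba; have := ltn_trans as1 bs2; rewrite ltnNge kba.
Qed.

(** Distinctness makes [index] inverse to [nth] on [groups], so that [gblock] reads the block at the
    right position. It holds because the k_j increase: unchanged indices are distinct, and the open
    intervals between them are disjoint. *)
Lemma groups_uniq : uniq (groups xs ys).
Proof.
have k_inj a b : (a <= p)%N -> (b <= p)%N -> k a = k b -> a = b.
  move=> ap bp kab; have [lt_ab|lt_ba|//] := ltngtP a b.
    by have := @k_ltn a b; rewrite lt_ab leqW // kab ltnn => /(_ isT).
  by have := @k_ltn b a; rewrite lt_ba leqW // kab ltnn => /(_ isT).
have kD a b : (0 < a <= p)%N -> (b <= p)%N -> [:: k a] <> D_ xs ys b.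
  move=> ap bp kaE; have /(D_grp_D_set (J := D_ xs ys b)) : k a \in D_ xs ys b.
    by rewrite -kaE mem_head.
  rewrite mem_D_set; have := k_in_I ap; rewrite mem_I_set => /andP[-> _] /=.
  suff -> : D_ xs ys b \in D_grp xs ys by move=> /(_ isT).
  by apply/D_grpP; exists b; rewrite -kaE.
pose L s := [seq G <- flatten [seq [:: [:: k j]; D_ xs ys j] | j <- s] | G != [::]].
have memL s G : G \in L s -> exists2 j, j \in s & G = [:: k j] \/ G = D_ xs ys j.
  rewrite mem_filter => /andP[_ /flattenP[? /mapP[j js ->]]].
  by rewrite !inE => /orP[/eqP->|/eqP->]; exists j => //; [left|right].
have L_uniq s : uniq s -> {in s, forall j, (0 < j <= p)%N} -> uniq (L s).
  elim: s => // j s IH; rewrite cons_uniq => /andP[js s_uniq] s_le.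
  have jp : (0 < j <= p)%N by apply: s_le; rewrite mem_head.
  have s_le' : {in s, forall j, (0 < j <= p)%N}.
    by move=> i i_s; apply: s_le; rewrite inE i_s orbT.
  have [jp0 jpp] := andP jp.
  have kjL : [:: k j] \notin L s.
    apply/negP => /memL[i i_s [[kE]|kE]]; have /andP[ip0 ipp] := s_le' i i_s.
      by move: js; rewrite (k_inj _ _ jpp ipp kE) i_s.
    exact: kD kE.
  have uL := IH s_uniq s_le'.
  have -> : L (j :: s) = [:: k j] :: (if D_ xs ys j != [::] then D_ xs ys j :: L s else L s) by [].
  case: ifP => [D0|_]; rewrite !cons_uniq uL ?kjL // inE negb_or kjL !andbT.
  apply/andP; split; first exact/eqP/kD.
  apply/negP => /memL[i i_s [DE|DE]]; have /andP[ip0 ipp] := s_le' i i_s.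
    exact: (kD i j (s_le' _ i_s) jpp (esym DE)).
  by move: js; rewrite (D_inj jpp ipp D0 DE) i_s.
have uL : uniq (L (iota 1 p)).
  by apply: L_uniq; rewrite ?iota_uniq // => j; rewrite mem_iota add1n ltnS.
have -> : groups xs ys =
  if D_ xs ys 0 != [::] then D_ xs ys 0 :: L (iota 1 p) else L (iota 1 p) by [].
case: ifP => [D0|//]; rewrite cons_uniq uL andbT.
apply/negP => /memL[j]; rewrite mem_iota add1n ltnS => jp [DE|DE].
  exact: (kD _ _ jp (leq0n p) (esym DE)).
by have /andP[j0 jpp] := jp; rewrite -(D_inj _ jpp D0 DE) in j0.
Qed.

Lemma gblock_groups (zs : seq (seq R)) q : (q < size (groups xs ys))%N ->
  gblock xs ys zs (nth [::] (groups xs ys) q) = nth [::] zs q.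
Proof. by move=> qs; rewrite /gblock index_uniq // groups_uniq. Qed.

End Groups.

(** * Prefix sums and normal decompositions *)

Lemma e_sum_split (R : rcfType) (ss : seq (seq R)) b r :
  sorted >=%R (flatten ss) -> (r <= size (nth [::] ss b))%N ->
  e_sum (start ss b + r) (flatten ss) =
  \sum_(0 <= q < b) vsum (nth [::] ss q) + e_sum r (nth [::] ss b).
Proof.
move=> ss_sorted rs; rewrite !e_sum_sorted ?sorted_block //; last first.
  case: r rs => [_|r rs]; last by rewrite addnS start_ltn.
  have [bs|sb] := leqP b (size ss); first by rewrite addn0 -start_size leq_start.
  by rewrite addn0 -start_size /start !take_oversize ?size_map // ltnW.
rewrite (big_cat_nat (n := start ss b)) ?leq_addr //= sum_blocks sum_in_block //.
by congr (_ + _); apply: eq_bigr => q _; rewrite sum_block.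
Qed.

Section NormalDecompositions.
Variables (R : rcfType) (xs ys : seq (seq R)).
Hypothesis shape_xy : shape xs = shape ys.
Hypothesis blocks_xy : forall b, (b < size xs)%N ->
  strictly_majorized (nth [::] xs b) (nth [::] ys b) \/ nth [::] xs b = nth [::] ys b.
Hypothesis x_sorted : sorted >=%R (flatten xs).
Hypothesis y_sorted : sorted >=%R (flatten ys).

Let size_xy : size xs = size ys.
Proof. by rewrite -(size_map size xs) -(size_map size ys) -!/(shape _) shape_xy. Qed.

Let start_xy b : start xs b = start ys b. Proof. by rewrite /start shape_xy. Qed.

Let size_block b : size (nth [::] xs b) = size (nth [::] ys b).
Proof.
have [bs|sb] := ltnP b (size xs); last by rewrite !nth_default // -size_xy.
by rewrite -!(nth_map [::] 0%N) -?size_xy // -!/(shape _) shape_xy.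
Qed.

Lemma vsum_block b : vsum (nth [::] xs b) = vsum (nth [::] ys b).
Proof.
have [bs|sb] := ltnP b (size xs); last by rewrite !nth_default // -size_xy.
by case: (blocks_xy bs) => [[sz _]|->//]; rewrite e_sum_full sz e_sum_full.
Qed.

Lemma strict_block b : nth [::] xs b != nth [::] ys b ->
  strictly_majorized (nth [::] xs b) (nth [::] ys b).
Proof.
move=> /eqP ne; have [bs|sb] := ltnP b (size xs); first by case: (blocks_xy bs).
by case: ne; rewrite !nth_default // -size_xy.
Qed.

(** Blocks before [b] contribute equal sums to both vectors, so the difference of the prefix sums is
    the one inside the strict block [b]. *)
Lemma e_sum_lt_in_block b l : nth [::] xs b != nth [::] ys b ->
  (start ys b < l < start ys b.+1)%N ->
  e_sum l (flatten xs) < e_sum l (flatten ys).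
Proof.
move=> /strict_block [_ lt_xy _]; rewrite startS => /andP[bl lb].
have bl' := ltnW bl; have lE := subnKC bl'; set r := (l - start ys b)%N in lE.
have r_gt0 : (0 < r)%N by rewrite subn_gt0.
have rs : (r < size (nth [::] ys b))%N by rewrite -lE ltn_add2l in lb.
have rs' : (r <= size (nth [::] xs b))%N by rewrite size_block ltnW.
rewrite -lE -{1}start_xy !e_sum_split // ?(ltnW rs) //.
apply: ler_ltD; first by apply: ler_sum => q _; rewrite vsum_block.
by apply: lt_xy; rewrite r_gt0 size_block -ltnS prednK // (leq_trans _ rs).
Qed.

(** In dimension one, equal sums would make the blocks equal. In higher dimension, if the block of
    [ys] were constant, its strictly larger first entry would dominate every entry of the block of
    [xs], against the equality of sums. *)
Lemma strict_block_ends b : nth [::] xs b != nth [::] ys b ->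
  (nth [::] ys b)`_(size (nth [::] ys b)).-1 < (nth [::] ys b)`_0.
Proof.
move=> ne; have [sz lt_uv tot] := strict_block ne.
have u_sorted := sorted_block b x_sorted; have v_sorted := sorted_block b y_sorted.
move: ne sz lt_uv tot u_sorted v_sorted; move: (nth _ xs b) (nth _ ys b) => u v.
move=> ne sz lt_uv; rewrite sz e_sum_full -{1}sz e_sum_full => tot u_sorted v_sorted.
have v_gt1 : (1 < size v)%N.
  case: u v ne sz tot {lt_uv u_sorted v_sorted} => [|a [|a' u]] [|c [|c' v]] //= ne _.
  by rewrite /vsum !big_seq1 => ac; rewrite ac eqxx in ne.
have v_gt0 := ltnW v_gt1.
rewrite ltNge; apply/negP => v_const.
have vE i : (i < size v)%N -> v`_i = v`_0.
  move=> i_v; apply/eqP; rewrite eq_le nth_sorted //= (le_trans v_const) //.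
  have i_v1 : (i <= (size v).-1)%N by rewrite -ltnS prednK.
  by rewrite nth_sorted // i_v1 prednK /=.
have := lt_uv 1%N; rewrite sz ltn_predRL v_gt1 => /(_ isT).
rewrite !e_sum_sorted ?sz // !big_nat1 => uv0.
have : vsum u < vsum v; last by rewrite tot ltxx.
rewrite /vsum (big_nth 0) [ltRHS](big_nth 0) sz !big_mkord.
apply: (ltr_sum_strict (j := Ordinal v_gt0)) => //= i _.
by rewrite vE //; apply: le_trans (ltW uv0); rewrite nth_sorted // sz ltn_ord.
Qed.

End NormalDecompositions.

(** * Selections in a Kronecker product *)

Section KronSelection.
Variables (R : rcfType) (n k : nat).
Implicit Types (x c : seq R) (h : nat -> nat).

Definition selection h : {set 'I_k * 'I_n} :=
  [set p : 'I_k * 'I_n | (p.2 < h p.1)%N].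

(* The selection [h] takes the [h j] largest components of [x], multiplied
   by [c`_j], for every [j]. *)
Definition selection_sum h x c : R := \sum_(j < k) c`_j * e_sum (h j) x.

Lemma big_selection (V : nmodType) h (F : 'I_k -> 'I_n -> V) :
  \sum_(p in selection h) F p.1 p.2 = \sum_(j < k) \sum_(i < n | (i < h j)%N) F j i.
Proof.
by rewrite pair_big_dep /=; apply: eq_bigl => p; rewrite inE.
Qed.

Lemma sum_below (V : nmodType) m (F : nat -> V) : (m <= n)%N ->
  \sum_(i < n | (i < m)%N) F i = \sum_(0 <= i < m) F i.
Proof. by move=> mn; rewrite big_mkord (big_ord_widen _ _ mn). Qed.

Lemma card_selection h : (forall j, (h j <= n)%N) ->
  #|selection h| = (\sum_(j < k) h j)%N.
Proof.
move=> hn; rewrite -sum1_card (big_selection h (fun _ _ => 1%N)).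
apply: eq_bigr => j _; rewrite (sum_below (fun=> 1%N)) //.
by rewrite sum_nat_const_nat subn0 muln1.
Qed.

Lemma selection_sumE h x c : size x = n -> sorted >=%R x ->
  (forall j, (h j <= n)%N) ->
  \sum_(p in selection h) x`_p.2 * c`_p.1 = selection_sum h x c.
Proof.
move=> xn x_sorted hn; rewrite (big_selection h (fun j i => x`_i * c`_j)).
apply: eq_bigr => j _; rewrite e_sum_sorted ?xn // -(sum_below (fun i => x`_i)) //.
by rewrite mulr_sumr; apply: eq_bigr => i _; rewrite mulrC.
Qed.

Lemma selection_sum_le h x c : size x = n -> size c = k -> sorted >=%R x ->
  (forall j, (h j <= n)%N) ->
  selection_sum h x c <= e_sum (\sum_(j < k) h j) (kron x c).
Proof.
move=> xn ck x_sorted hn; rewrite -card_selection // -selection_sumE //.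
exact: sum_le_e_sum (perm_kron_enum xn ck) _.
Qed.

(** From an optimal set of pairs only the number [h j] of pairs in each column is kept. Replacing a
    column by its [h j] largest components does not lower the sum, as [c] is nonnegative. *)
Lemma optimal_selection x c l : size x = n -> size c = k -> sorted >=%R x ->
  all (fun a => 0 <= a) c -> (l <= n * k)%N ->
  exists h, [/\ forall j, (h j <= n)%N, (\sum_(j < k) h j)%N = l
    & selection_sum h x c = e_sum l (kron x c)].
Proof.
move=> xn ck x_sorted c0 lnk.
have [|A cardA sumA] := e_sum_attained (perm_kron_enum xn ck) (l := l).
  by rewrite card_prod !card_ord mulnC.
pose B (j : nat) := [set i : 'I_n | if insub j is Some j' then (j', i) \in A else false].
pose h j := #|B j|.
have hn j : (h j <= n)%N by rewrite -[X in (_ <= X)%N]card_ord max_card.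
have sumAE (V : nmodType) (F : 'I_k -> 'I_n -> V) :
    \sum_(p in A) F p.1 p.2 = \sum_(j < k) \sum_(i in B j) F j i.
  rewrite pair_big_dep /=; apply: eq_bigl => -[j i] /=.
  by rewrite inE valK.
have hl : (\sum_(j < k) h j)%N = l.
  rewrite -cardA -sum1_card (sumAE _ (fun _ _ => 1%N)).
  by apply: eq_bigr => j _; rewrite sum1_card.
exists h; split => //; apply/eqP; rewrite eq_le -{1}hl selection_sum_le //= -sumA.
rewrite (sumAE _ (fun j i => x`_i * c`_j)); apply: ler_sum => j _.
rewrite -mulr_suml mulrC ler_wpM2l //; last exact: sum_le_e_sum (perm_nth_enum xn) _.
by apply: (allP c0); rewrite mem_nth // ck.
Qed.

(* Moving one component from column [j] to column [d] does not increase an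
   optimal sum. *)
Lemma optimal_selection_exchange h x c l j d a b :
  size x = n -> size c = k -> sorted >=%R x -> all (fun a => 0 <= a) c ->
  (forall j, (h j <= n)%N) -> (\sum_(j < k) h j)%N = l ->
  selection_sum h x c = e_sum l (kron x c) ->
  (j < k)%N -> (d < k)%N -> (a < h j)%N -> (h d <= b < n)%N ->
  x`_b * c`_d <= x`_a * c`_j.
Proof.
move=> xn ck x_sorted /allP c0 hn hl opt jk dk ahj /andP[hdb bn].
have c_ge0 i : (i < k)%N -> 0 <= c`_i by move=> ik; rewrite c0 // mem_nth ?ck.
have [jd|jd] := eqVneq j d.
  rewrite -jd ler_wpM2r ?c_ge0 // nth_sorted // xn bn andbT.
  by rewrite (leq_trans (ltnW ahj)) // jd.
have an : (a < n)%N := leq_trans ahj (hn j).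
(* By monotonicity it suffices to compare the largest component not taken against [d] with the
   smallest one taken against [j]; [g] exchanges exactly these two. *)
apply: (@le_trans _ _ (x`_(h d) * c`_d)).
  by rewrite ler_wpM2r ?c_ge0 // nth_sorted // hdb xn.
apply: (@le_trans _ _ (x`_(h j).-1 * c`_j)); last first.
  rewrite ler_wpM2r ?c_ge0 // nth_sorted // xn.
  by case: (h j) ahj (hn j) => // m; rewrite ltnS => -> ->.
pose g i := if i == j then (h j).-1 else if i == d then (h d).+1 else h i.
have gn i : (g i <= n)%N.
  rewrite /g; case: ifP => _; first exact: leq_trans (leq_pred _) (hn j).
  by case: ifP => _ //; apply: leq_ltn_trans hdb bn.
have sum2 (V : zmodType) (F G : nat -> V) : (forall i, i != j -> i != d -> F i = G i) ->
    \sum_(i < k) F i - \sum_(i < k) G i = F j + F d - (G j + G d).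
  move=> FG; have jd' : Ordinal dk != Ordinal jk by rewrite -val_eqE eq_sym.
  rewrite (bigD1 (Ordinal jk)) //= (bigD1 (Ordinal dk)) //=.
  rewrite [X in _ - X](bigD1 (Ordinal jk)) //= [X in _ - (_ + X)](bigD1 (Ordinal dk)) //=.
  rewrite !addrA (eq_bigr (fun i : 'I_k => G i)); last first.
    by move=> i /andP[ij id]; apply: FG.
  by rewrite opprD addrACA subrr addr0.
have gj : g j = (h j).-1 by rewrite /g eqxx.
have gd : g d = (h d).+1 by rewrite /g eqxx eq_sym (negbTE jd).
have g_other i : i != j -> i != d -> g i = h i.
  by rewrite /g => /negbTE -> /negbTE ->.
have gl : (\sum_(i < k) g i)%N = l.
  (* The count is done in the integers, since [sum2] needs subtraction. *)
  rewrite -hl; apply/eqP; rewrite -(eqr_nat int) -subr_eq0 !natr_sum.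
  rewrite (sum2 _ (fun i => (g i)%:R) (fun i => (h i)%:R)); last first.
    by move=> i ij id; rewrite g_other.
  rewrite gj gd; case: (h j) ahj => // m _.
  by rewrite -!natrD addnS subr_eq0.
have := selection_sum_le xn ck x_sorted gn; rewrite gl -opt -subr_le0.
rewrite /selection_sum (sum2 _ (fun i => c`_i * e_sum (g i) x) (fun i => c`_i * e_sum (h i) x)).
  have hn' m : (m <= n)%N -> e_sum m x = \sum_(0 <= i < m) x`_i.
    by move=> mn; rewrite e_sum_sorted ?xn.
  rewrite gj gd !hn' ?(leq_ltn_trans hdb) //; last by apply: leq_trans (leq_pred _) (hn j).
  case: (h j) ahj => // m _; rewrite !big_nat_recr //= !mulrDr => le0.
  rewrite -subr_le0; apply: le_trans le0; rewrite le_eqVlt; apply/orP; left; apply/eqP; ring.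
by move=> i ij id; rewrite g_other.
Qed.

End KronSelection.

(** * Optimal selections are constant on the groups of strict blocks *)

Lemma embedded_extremes (R : rcfType) (x y : seq R) :
  x != [::] -> all (fun a => 0 <= a) x -> embedded x y ->
  (exists2 b, b \in y & forall a, a \in x -> a < b) /\
  (exists2 b, b \in y & forall a, a \in x -> b < a).
Proof.
move=> x_neq0 /allP x_ge0 /andP[lt_max lt_min].
have incr_sorted : sorted <=%R (incr x) by exact/sort_sorted/le_total.
have x_gt0 : (0 < size x)%N by case: (x) x_neq0.
have y_gt0 : (0 < size y)%N.
  (* An empty [y] would have the default 0 as its largest component, which does not exceed a
     component of the nonnegative [x]. *)
  rewrite lt0n; apply/negP => /eqP/size0nil yE; move: lt_max.
  by rewrite yE /= ltNge x_ge0 // -(mem_sort >=%R) mem_nth ?size_sort.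
split.
  exists (decr y)`_0 => [|a ax]; first by rewrite -(mem_sort >=%R) mem_nth ?size_sort.
  by apply: le_lt_trans lt_max; rewrite le_nth0 ?decr_sorted // mem_sort.
exists (incr y)`_0 => [|a ax]; first by rewrite -(mem_sort <=%R) mem_nth ?size_sort.
apply: lt_le_trans lt_min _; move: ax; rewrite -(mem_sort <=%R) => /(nthP 0)[i i_x <-].
by apply: (sorted_leq_nth le_trans (@lexx _ R) 0 incr_sorted) => //; apply: leq_ltn_trans i_x.
Qed.

Section Constancy.
Variables (R : rcfType) (psis phis chis : seq (seq R)) (h : nat -> nat).
Let phi := flatten phis.
Let chi := flatten chis.

Hypothesis shape_eq : shape psis = shape phis.
Hypothesis phi_sorted : sorted >=%R phi.
Hypothesis phi_ge0 : all (fun a => 0 <= a) phi.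
Hypothesis chi_gt0 : all (fun a => 0 < a) chi.
Hypothesis size_chis : size chis = size (groups psis phis).
Hypothesis strict_ends : forall b, nth [::] psis b != nth [::] phis b ->
  (nth [::] phis b)`_(size (nth [::] phis b)).-1 < (nth [::] phis b)`_0.
Hypothesis not_interior : forall b j, nth [::] psis b != nth [::] phis b ->
  (j < size chi)%N -> ~~ (start phis b < h j < start phis b.+1)%N.
Hypothesis exchange : forall j d a b, (j < size chi)%N -> (d < size chi)%N ->
  (a < h j)%N -> (h d <= b < size phi)%N -> phi`_b * chi`_d <= phi`_a * chi`_j.
Hypothesis h_le : forall j, (h j <= size phi)%N.

(** Suppose block [b] is fully taken against [j] and untouched against [d]. As no [h i] is interior
    to the block, every component of the group is of one of these two kinds. Exchanging the last
    component of the block with the first bounds the ratio of each component of the second kind to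
    each of the first kind by [g_u] of the block, and [l_u_gap] contradicts the assumption on the
    uniformity indices. *)
Lemma no_gap q b j d : (q < size chis)%N ->
  nth [::] psis b != nth [::] phis b -> g_u (nth [::] phis b) < l_u (nth [::] chis q) ->
  (start chis q <= j < start chis q.+1)%N -> (start chis q <= d < start chis q.+1)%N ->
  (start phis b.+1 <= h j)%N -> (start phis b < h d)%N.
Proof.
move=> qs nb gl jq dq bj; rewrite ltnNge; apply/negP => db.
have in_size i : (start chis q <= i < start chis q.+1)%N -> (i < size chi)%N.
  by case/andP => _; apply: pos_ltn_size.
have chi0 i : (i < size chi)%N -> 0 < chi`_i by move=> ?; rewrite (allP chi_gt0) ?mem_nth.
have ends := strict_ends nb; set v := nth [::] phis b in gl ends *.
have v_gt0 : (0 < size v)%N by case: (v) ends; rewrite ?ltxx.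
have v_pred : ((size v).-1 < size v)%N by rewrite prednK.
have v_ge0 : 0 <= v`_(size v).-1.
  by apply: (allP phi_ge0); rewrite -nth_flatten_start // mem_nth // start_ltn.
have v0_gt0 : 0 < v`_0 by apply: le_lt_trans ends.
have b_first : phi`_(start phis b) = v`_0 by rewrite -[start _ _]addn0 nth_flatten_start.
have b_last : phi`_(start phis b + (size v).-1) = v`_(size v).-1 by rewrite nth_flatten_start.
have swap i i' : (i < size chi)%N -> (i' < size chi)%N ->
    (start phis b.+1 <= h i)%N -> (h i' <= start phis b)%N ->
    v`_0 * chi`_i' <= v`_(size v).-1 * chi`_i.
  move=> i_s i'_s bi i'b; rewrite -b_first -b_last exchange // ?i'b.
    by apply: leq_trans bi; rewrite startS ltn_add2l.
  by have := start_ltn v_gt0; rewrite addn0.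
have v_sorted : sorted >=%R v by apply: sorted_block.
have gE : g_u v = v`_(size v).-1 / v`_0 by apply: g_u_ends.
(* [P] speaks of values because [l_u] compares distinct values. Equal values cannot be of both
   kinds, since the first component of the block exceeds the last. *)
pose P u := [exists i : 'I_(size chi), [&& (start chis q <= i < start chis q.+1)%N,
   chi`_i == u & (start phis b.+1 <= h i)%N]].
move: gl; rewrite ltNge => /negP; apply.
apply: (l_u_gap (P := P) (x := chi`_j) (y := chi`_d)).
- move=> a /mem_block_pos[i iq <-]; exact: chi0 (in_size i iq).
- by rewrite gE ltr_pdivrMr // mul1r.
- exact: pos_mem_block.
- by apply/existsP; exists (Ordinal (in_size j jq)); rewrite jq eqxx.
- exact: pos_mem_block.
- apply/negP => /existsP[i /and3P[iq /eqP iE bi]].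
  have := swap i d (in_size i iq) (in_size d dq) bi db.
  by rewrite iE ler_pM2r ?chi0 ?in_size // leNgt ends.
- move=> u w _ /mem_block_pos[i' i'q <-] /existsP[i /and3P[iq /eqP <- bi]] /negP Pi'.
  rewrite gE mulrAC ler_pdivlMr // [leLHS]mulrC.
  apply: swap (in_size _ iq) (in_size _ i'q) bi _; rewrite leqNgt; apply/negP => bi'.
  have := not_interior nb (in_size _ i'q); rewrite bi' -leqNgt => b'i'.
  by apply: Pi'; apply/existsP; exists (Ordinal (in_size i' i'q)); rewrite i'q eqxx.
Qed.

Hypothesis embeds : forall i J J_i,
  i \in I_set psis phis -> J \in D_grp psis phis -> nearest i J J_i ->
  ratio_embeds (gblock psis phis chis [:: i]) (gblock psis phis chis J)
               (block phis i) (block phis J_i).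
Hypothesis l_u_D : forall J i, J \in D_grp psis phis -> i \in D_set psis phis ->
  g_u (block phis i) < l_u (gblock psis phis chis J).
Hypothesis l_u_I : forall i J s,
  i \in I_set psis phis -> J \in D_grp psis phis -> s \in [:: max_idx J; min_idx J] ->
  g_u (block phis s) < l_u (gblock psis phis chis [:: i]).

(** Suppose h d < h j and let [b] be the block of phi that contains position [h d]. If [b] is
    strict, it is untouched against [d] and fully taken against [j], which [no_gap] excludes. If [b]
    is unchanged, the same contradiction is reached at the block of [J] nearest to it, in the group
    of chi that belongs to [b]. *)
Lemma selection_constant J j d :
  let q := index J (groups psis phis) in
  J \in D_grp psis phis ->
  (start chis q <= j < start chis q.+1)%N -> (start chis q <= d < start chis q.+1)%N ->
  h j = h d.
Proof.
move=> q JD jq dq.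
wlog dj : j d jq dq / (h d < h j)%N.
  by move=> H; case: (ltngtP (h j) (h d)) => // lt; [apply/esym|]; apply: H.
have qs : (q < size chis)%N by rewrite size_chis index_mem mem_groups JD orbT.
have size_eq : size psis = size phis.
  by rewrite -(size_map size psis) -(size_map size phis) -!/(shape _) shape_eq.
have in_size p i : (p < size chis)%N -> (start chis p <= i < start chis p.+1)%N -> (i < size chi)%N.
  by move=> ps /andP[_]; apply: pos_ltn_size.
have j_s := in_size q j qs jq; have d_s := in_size q d qs dq.
have dn : (h d < size phi)%N by apply: leq_trans (h_le j).
have [b bs /andP[bd db]] := pos_block dn.
have bn : (start phis b < size phi)%N by apply: leq_ltn_trans dn.
have [bI|bD] := eqVneq (nth [::] psis b) (nth [::] phis b); last first.
  have hdE : h d = start phis b.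
    by apply/eqP; rewrite eqn_leq bd andbT leqNgt; have := not_interior bD d_s; rewrite db andbT.
  have bj : (start phis b.+1 <= h j)%N.
    by rewrite leqNgt; have := not_interior bD j_s; rewrite -hdE dj.
  have gl : g_u (nth [::] phis b) < l_u (nth [::] chis q).
    by apply: (l_u_D (i := b.+1)) => //; rewrite mem_D_set /block /= bD size_eq.
  by have := no_gap qs bD gl jq dq bj; rewrite hdE ltnn.
(* The next component [h d] against [chi`_d] lies in an unchanged block: by the
   embedding, one component of the group of that block takes the whole strict
   block [Ji] and another one takes nothing of it. *)
have iI : b.+1 \in I_set psis phis by rewrite mem_I_set /block /= bI eqxx size_eq.
have [Ji Ji_end near] := nearest_end JD iI.
have JiD : Ji \in D_set psis phis by case/andP: near => JiJ _; apply: D_grp_D_set JD JiJ.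
move: (JiD); rewrite mem_D_set /block => /andP[JiN /andP[Ji_gt0 _]].
have := embeds iI JD near; rewrite /ratio_embeds /gblock /block -/q /=.
set p := index _ _; have ps : (p < size chis)%N.
  by rewrite size_chis index_mem mem_groups map_f.
have gl := l_u_I iI JD Ji_end; rewrite /gblock -/p /block in gl.
move=> /embedded_extremes[].
- apply/negP => /eqP/(congr1 size); rewrite size_kron => /eqP; rewrite muln_eq0.
  move: (pos_mem_block jq); rewrite -/chi.
  have /pos_mem_block : (start phis b <= h d < start phis b.+1)%N by rewrite bd.
  by case: (nth _ chis q) => // ? ?; case: (nth _ phis b).
- apply/allP => _ /allpairsP[[u w] [/= /mem_block_pos[i iq <-] /mem_block_pos[a ab <-] ->]].
  rewrite mulr_ge0 //; first by rewrite ltW // (allP chi_gt0) ?mem_nth ?(in_size q).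
  by rewrite (allP phi_ge0) // mem_nth //; case/andP: ab => _; apply: pos_ltn_size.
have bb : (start phis b <= start phis b < start phis b.+1)%N.
  by rewrite leqnn (leq_ltn_trans bd).
have dd : (start phis b <= h d < start phis b.+1)%N by rewrite bd.
move=> [_ /allpairsP[[u w] [/= uC wP ->]] lt_uw] [_ /allpairsP[[u' w'] [/= uC' wP' ->]] lt_uw'].
move/mem_block_pos: uC => [d1 d1p uE]; move/mem_block_pos: wP => [a1 a1b wE].
move/mem_block_pos: uC' => [d2 d2p uE']; move/mem_block_pos: wP' => [a2 a2b wE'].
have Ji_s : (Ji.-1 < size phis)%N.
  by rewrite -size_eq; move: JiD; rewrite mem_D_set => /andP[_ /andP[]]; case: (Ji).
have phi_s a : (start phis Ji.-1 <= a < start phis Ji.-1.+1)%N -> (a < size phi)%N.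
  by case/andP => _; apply: pos_ltn_size.
have d1_s := in_size p d1 ps d1p; have d2_s := in_size p d2 ps d2p.
(* The product at [d1], [a1] exceeds the one at [j], [start phis b], which is taken; so optimality
   forces it to be taken too, and a strict block is never taken in part. *)
have d1_big : (start phis Ji.-1.+1 <= h d1)%N.
  have a1d1 : (a1 < h d1)%N.
    rewrite ltnNge; apply/negP => d1a1.
    have := exchange j_s d1_s (leq_ltn_trans bd dj) (b := a1); rewrite d1a1 phi_s // => /(_ isT).
    rewrite leNgt -uE -wE [X in _ < X]mulrC [X in X < _]mulrC in lt_uw *.
    rewrite lt_uw //; apply/allpairsP; exists (chi`_j, phi`_(start phis b)).
    by split => //=; apply: pos_mem_block.
  rewrite leqNgt; have := not_interior JiN d1_s; rewrite (leq_ltn_trans _ a1d1) //.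
  by case/andP: a1b.
(* Dually, the product at [d2], [a2] is below the one at [d], [h d], which is not taken. *)
have d2_small : (h d2 <= start phis Ji.-1)%N.
  have d2a2 : (h d2 <= a2)%N.
    rewrite leqNgt; apply/negP => a2d2.
    have := exchange d2_s d_s a2d2 (b := h d); rewrite leqnn dn => /(_ isT).
    rewrite leNgt -uE' -wE' [X in _ < X]mulrC [X in X < _]mulrC in lt_uw' *.
    rewrite lt_uw' //; apply/allpairsP; exists (chi`_d, phi`_(h d)).
    by split => //=; apply: pos_mem_block.
  rewrite leqNgt; have := not_interior JiN d2_s; rewrite negb_and -[X in _ || X]leqNgt => /orP[//|].
  by rewrite leqNgt (leq_ltn_trans d2a2) //; case/andP: a2b.
have := no_gap ps JiN gl d1p d2p d1_big.
by rewrite ltnNge d2_small.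
Qed.

End Constancy.

(** * Partial recovery *)

Lemma le_eucl_dist (R : rcfType) (x y : seq R) r :
  size x = size y -> (r < size x)%N -> `|x`_r - y`_r| <= eucl_dist x y.
Proof.
move=> sz rx; rewrite -sqrtr_sqr /eucl_dist.
have zr : (r < size (zip x y))%N by rewrite size_zip sz minnn -sz.
rewrite ler_wsqrtr // (big_nth (0, 0)) big_mkord (bigD1 (Ordinal zr)) //= nth_zip //=.
by rewrite lerDl sumr_ge0 // => i _; apply: sqr_ge0.
Qed.

Section Recovery.
Variables (R : rcfType) (n k : nat) (psi phi : n.-tuple R) (chi : k.-tuple R).
Variables (psis phis chis : seq (seq R)).
Hypotheses (psi_sorted : sorted >=%R psi) (phi_sorted : sorted >=%R phi).
Hypotheses (phi_ge0 : all (fun a => 0 <= a) phi) (chi_gt0 : all (fun a => 0 < a) chi).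
Hypotheses (psi_sum : \sum_(a <- psi) a = 1) (phi_sum : \sum_(a <- phi) a = 1).
Hypothesis chi_sum : \sum_(a <- chi) a = 1.
Hypothesis psi_phi : majorized psi phi.
Hypothesis normal : normal_decompositions psi phi psis phis.
Hypothesis chi_chis : decomposition chi chis.
Hypothesis size_chis : size chis = size (groups psis phis).
Hypothesis embeds : forall i J J_i,
  i \in I_set psis phis -> J \in D_grp psis phis -> nearest i J J_i ->
  ratio_embeds (gblock psis phis chis [:: i]) (gblock psis phis chis J)
               (block phis i) (block phis J_i).
Hypothesis l_u_D :
  \big[Num.min/1]_(J <- D_grp psis phis) l_u (gblock psis phis chis J)
    > \big[Num.max/0]_(i <- D_set psis phis) g_u (block phis i).
Hypothesis l_u_I :
  \big[Num.min/1]_(i <- I_set psis phis) l_u (gblock psis phis chis [:: i])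
    > \big[Num.max/0]_(J <- D_grp psis phis)
        Num.max (g_u (block phis (max_idx J))) (g_u (block phis (min_idx J))).

Let psiE : flatten psis = psi. Proof. by case: normal => -[]. Qed.
Let phiE : flatten phis = phi. Proof. by case: normal => _ -[]. Qed.
Let chiE : flatten chis = chi. Proof. by case: chi_chis. Qed.

Let shape_eq : shape psis = shape phis. Proof. by case: normal. Qed.

Let blocks_eq b : (b < size psis)%N ->
  strictly_majorized (nth [::] psis b) (nth [::] phis b) \/ nth [::] psis b = nth [::] phis b.
Proof. by case: normal => _ _ _ + _ bs => /(_ b.+1); apply. Qed.

Let chi_ge0 : all (fun a => 0 <= a) chi.
Proof. by apply: sub_all chi_gt0 => a /ltW. Qed.

Let e_sum_le l : (l <= n)%N -> e_sum l psi <= e_sum l phi.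
Proof.
move=> ln; case: psi_phi => _ le_e tot; case: l ln => [|l] ln.
  by rewrite /e_sum !take0.
have [l_n|l_n] := ltnP l.+1 n; first by apply: le_e; rewrite size_tuple /= ltn_predRL.
have -> : l.+1 = size psi by rewrite size_tuple; apply/eqP; rewrite eqn_leq ln.
by rewrite tot.
Qed.

Let chi_ge0_nth (j : 'I_k) : 0 <= chi`_j.
Proof. by rewrite (allP chi_ge0) // mem_nth // size_tuple. Qed.

Let selection_sum_psi_phi (h : nat -> nat) : (forall j, (h j <= n)%N) ->
  selection_sum k h psi chi <= selection_sum k h phi chi.
Proof. by move=> hn; apply: ler_sum => j _; rewrite ler_wpM2l ?e_sum_le. Qed.

Lemma tight_selection_constant (h : nat -> nat) l J j d :
  (forall j, (h j <= n)%N) -> (\sum_(j < k) h j)%N = l ->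
  selection_sum k h psi chi = e_sum l (kron psi chi) ->
  e_sum l (kron phi chi) <= e_sum l (kron psi chi) ->
  let q := index J (groups psis phis) in
  J \in D_grp psis phis ->
  (start chis q <= j < start chis q.+1)%N -> (start chis q <= d < start chis q.+1)%N ->
  h j = h d.
Proof.
move=> hn hl opt_psi le_l q JD; have size_phi := size_tuple phi; have size_chi := size_tuple chi.
have le_phi := selection_sum_le size_phi size_chi phi_sorted hn; rewrite hl in le_phi.
have opt_phi : selection_sum k h phi chi = e_sum l (kron phi chi).
  by apply/eqP; rewrite eq_le le_phi (le_trans le_l) // -opt_psi selection_sum_psi_phi.
(* The two sums agree and their terms are ordered, so the terms agree. As chi_j > 0, the partial
   sums of psi and phi at [h j] coincide, which keeps [h j] out of the interior of strict blocks. *)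
have eq_e j' : (j' < k)%N -> e_sum (h j') psi = e_sum (h j') phi.
  move=> j'k; have : \sum_(i < k) chi`_i * (e_sum (h i) phi - e_sum (h i) psi) == 0.
    under eq_bigr do rewrite mulrBr.
    rewrite sumrB subr_eq0 eq_le -!/(selection_sum k h _ chi) selection_sum_psi_phi // andbT.
    by rewrite opt_phi opt_psi.
  rewrite psumr_eq0 => [|i _]; last by rewrite mulr_ge0 ?subr_ge0 ?e_sum_le.
  move=> /allP/(_ (Ordinal j'k)); rewrite mem_index_enum => /(_ isT) /=.
  rewrite mulf_eq0 gt_eqF /=; last by rewrite (allP chi_gt0) ?mem_nth ?size_chi.
  by rewrite subr_eq0 => /eqP.
apply: (selection_constant (h := h)) => //; rewrite ?phiE ?chiE ?size_phi ?size_chi //.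
- by apply: strict_block_ends; rewrite ?psiE ?phiE.
- move=> b i nb ik; apply/negP => hi.
  have := e_sum_lt_in_block shape_eq blocks_eq _ _ nb hi; rewrite psiE phiE.
  by rewrite eq_e // ltxx => /(_ psi_sorted phi_sorted).
- move=> i d' a b ik d'k; rewrite ?phiE ?chiE.
  exact: (optimal_selection_exchange size_phi size_chi phi_sorted chi_ge0 hn hl opt_phi).
- move=> J' i J'D iD.
  apply: le_lt_trans (lt_le_trans l_u_D _).
    exact: (@le_bigmax_seq _ _ _ _ 0 i predT (fun i => g_u (block phis i))).
  exact: (@ge_bigmin_seq _ _ _ _ 1 J' predT (fun J => l_u (gblock psis phis chis J))).
- move=> i J' s iI J'D sE.
  apply: le_lt_trans (lt_le_trans l_u_I _); last first.
    exact: (@ge_bigmin_seq _ _ _ _ 1 i predT (fun i => l_u (gblock psis phis chis [:: i]))).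
  apply: (@bigmax_sup_seq _ _ _ _ _ J') => //.
  by move: sE; rewrite !inE le_max => /orP[/eqP->|/eqP->]; rewrite lexx ?orbT.
Qed.

(** * Perturbations of the auxiliary vector inside the groups of strict blocks *)

Section Perturbation.
Variables (omega : k.-tuple R) (omegas : seq (seq R)).
Hypothesis omega_omegas : decomposition omega omegas.
Hypothesis shape_omegas : shape omegas = shape chis.
Hypothesis omega_I : forall G, G \in I_grp psis phis ->
  gblock psis phis omegas G = gblock psis phis chis G.

Let omegaE : flatten omegas = omega. Proof. by case: omega_omegas. Qed.

Let start_omegas q : start omegas q = start chis q.
Proof. by rewrite /start shape_omegas. Qed.

Lemma omega_group q : (q < size chis)%N ->
  nth [::] omegas q = nth [::] chis q \/
  exists2 J, J \in D_grp psis phis & q = index J (groups psis phis).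
Proof.
rewrite size_chis => qs; have := mem_nth [::] qs; rewrite mem_groups => /orP[GI|GD].
  by left; have := omega_I GI; rewrite !gblock_groups.
by right; exists (nth [::] (groups psis phis) q) => //; rewrite index_uniq // groups_uniq.
Qed.

(** Where [h] is constant, the partial sum of phi factors out and only the sum of the block of omega
    remains; the other blocks of omega are those of chi. *)
Lemma selection_sum_omega (h : nat -> nat) :
  (forall J j d, let q := index J (groups psis phis) in
    J \in D_grp psis phis ->
    (start chis q <= j < start chis q.+1)%N -> (start chis q <= d < start chis q.+1)%N ->
    h j = h d) ->
  (forall G, G \in D_grp psis phis ->
    vsum (gblock psis phis omegas G) = vsum (gblock psis phis chis G)) ->
  selection_sum k h phi omega = selection_sum k h phi chi.
Proof.
move=> h_const omega_D.
have sum_groups (c : seq R) : selection_sum k h phi c = \sum_(0 <= q < size chis)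
    \sum_(start chis q <= j < start chis q.+1) c`_j * e_sum (h j) phi.
  by rewrite -(sum_blocks _ (fun j => c`_j * e_sum (h j) phi)) start_size chiE size_tuple big_mkord.
rewrite !sum_groups; apply: eq_big_nat => q /andP[_ qs]; have [omega_q|[J JD qE]] := omega_group qs.
  apply: eq_big_nat => j /andP[qj jq]; congr (_ * _).
  rewrite -(subnKC qj) -{1}start_omegas -omegaE -chiE !nth_flatten_start ?omega_q //.
    by rewrite ltn_subLR // -startS.
  by rewrite ltn_subLR // -startS.
have hE (c : seq R) : \sum_(start chis q <= j < start chis q.+1) c`_j * e_sum (h j) phi =
    (\sum_(start chis q <= j < start chis q.+1) c`_j) * e_sum (h (start chis q)) phi.
  rewrite mulr_suml; apply: eq_big_nat => j /andP[qj jq]; congr (_ * e_sum _ _).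
  by apply: (h_const J); rewrite -?qE ?qj ?leqnn // (leq_ltn_trans qj).
have := omega_D J JD; rewrite /gblock -qE -!sum_block omegaE chiE !start_omegas => sumE.
by rewrite !hE sumE.
Qed.

Lemma omega_close delta (j : 'I_k) : 0 < delta ->
  (forall G, G \in D_grp psis phis ->
    eucl_dist (gblock psis phis omegas G) (gblock psis phis chis G) < delta) ->
  `|omega`_j - chi`_j| < delta.
Proof.
move=> delta0 omega_D.
have [|q qs /andP[qj jq]] := @pos_block _ chis j; first by rewrite chiE size_tuple.
have rs : (j - start chis q < size (nth [::] chis q))%N by rewrite ltn_subLR // -startS.
have size_q : size (nth [::] omegas q) = size (nth [::] chis q).
  by rewrite -!nth_shape shape_omegas.
rewrite -(subnKC qj) -{1}start_omegas -omegaE -chiE !nth_flatten_start ?size_q //.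
have [->|[J JD qE]] := omega_group qs; first by rewrite subrr normr0.
apply: le_lt_trans (le_eucl_dist size_q _) _; first by rewrite size_q.
by have := omega_D J JD; rewrite /gblock -qE.
Qed.

End Perturbation.

Lemma recovery_majorized :
  exists2 delta : R, 0 < delta &
    forall (omega : k.-tuple R) omegas,
      \sum_(a <- omega) a = 1 ->
      decomposition omega omegas ->
      shape omegas = shape chis ->
      (forall G, G \in I_grp psis phis ->
         gblock psis phis omegas G = gblock psis phis chis G) ->
      (forall G, G \in D_grp psis phis ->
         eucl_dist (gblock psis phis omegas G) (gblock psis phis chis G) < delta /\
         vsum (gblock psis phis omegas G) = vsum (gblock psis phis chis G)) ->
      majorized (kron psi chi) (kron phi omega).
Proof.
pose gap l := e_sum l (kron phi chi) - e_sum l (kron psi chi).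
(* A selection sum for phi drops by at most k * delta when chi becomes omega, since the partial sums
   of phi are at most 1. Dividing by [k.+1] makes this at most any positive gap, with a denominator
   that is never zero. *)
pose delta := \big[Num.min/1]_(l < (n * k).+1 | 0 < gap l) (gap l / k.+1%:R).
have delta_gt0 : 0 < delta.
  by apply: lt_bigmin => // l gap_l; rewrite divr_gt0.
exists delta => // omega omegas omega_sum omega_dec omega_shape omega_I omega_D.
have omega_dist G : G \in D_grp psis phis ->
    eucl_dist (gblock psis phis omegas G) (gblock psis phis chis G) < delta.
  by case/omega_D.
have omega_vsum G : G \in D_grp psis phis ->
    vsum (gblock psis phis omegas G) = vsum (gblock psis phis chis G).
  by case/omega_D.
have size_psi := size_tuple psi; have size_phi := size_tuple phi.
have size_chi := size_tuple chi; have size_omega := size_tuple omega.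
have size_kr : size (kron psi chi) = size (kron phi omega).
  by rewrite !size_kron size_psi size_phi size_chi size_omega.
split=> // [l /andP[_ l_le]|]; last first.
  rewrite {2}size_kr !e_sum_full !vsum_kron /vsum.
  by rewrite psi_sum phi_sum chi_sum omega_sum.
have lnk : (l <= n * k)%N.
  by apply: leq_trans l_le _; rewrite size_kron size_psi size_chi leq_pred.
(* Either [l] is tight, and a selection constant on the groups gives the same sum for omega as for
   chi, or the positive gap absorbs the perturbation. *)
have [le_l|] := leP (e_sum l (kron phi chi)) (e_sum l (kron psi chi)).
  have [h [hn hl opt]] := optimal_selection size_psi size_chi psi_sorted chi_ge0 lnk.
  have h_const J j d := tight_selection_constant (J := J) (j := j) (d := d) hn hl opt le_l.
  rewrite -opt (le_trans (selection_sum_psi_phi hn)) //.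
  rewrite -(selection_sum_omega omega_dec omega_shape omega_I h_const omega_vsum) -hl.
  exact: selection_sum_le size_phi size_omega phi_sorted hn.
rewrite -subr_gt0 -/(gap l) => gap_gt0.
have [h [hn hl opt]] := optimal_selection size_phi size_chi phi_sorted chi_ge0 lnk.
have := selection_sum_le size_phi size_omega phi_sorted hn; rewrite hl; apply: le_trans.
have delta_le : delta * k.+1%:R <= gap l.
  have l_lt : (l < (n * k).+1)%N by rewrite ltnS.
  rewrite -ler_pdivlMr //.
  exact: (@bigmin_le_cond _ _ _ 1 (Ordinal l_lt) (fun l => 0 < gap l)
            (fun l => gap l / k.+1%:R)).
have e01 m : (m <= n)%N -> 0 <= e_sum m phi <= 1.
  move=> mn; have sumE m' : (m' <= n)%N -> e_sum m' phi = \sum_(0 <= i < m') phi`_i.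
    by move=> mn'; rewrite e_sum_sorted ?size_phi.
  have phi0 i : (i < n)%N -> 0 <= phi`_i.
    by move=> lt_in; rewrite (allP phi_ge0) ?mem_nth ?size_phi.
  have <- : e_sum n phi = 1 by rewrite -phi_sum -[RHS]e_sum_full size_phi.
  have sum_ge0 a b : (b <= n)%N -> 0 <= \sum_(a <= i < b) phi`_i.
    by move=> bn; rewrite big_nat sumr_ge0 // => i /andP[_ ib]; rewrite phi0 // (leq_trans ib).
  rewrite !sumE // sum_ge0 //= [leRHS](big_cat_nat (n := m)) //=.
  by rewrite lerDl sum_ge0.
rewrite /gap -opt in delta_le.
have diff : selection_sum k h phi chi - selection_sum k h phi omega <= delta * k%:R.
  rewrite /selection_sum -sumrB mulr_natr -[X in _ *+ X]card_ord -sumr_const.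
  apply: ler_sum => j _; rewrite -mulrBl.
  apply: le_trans (ler_norm _) _; rewrite normrM distrC.
  have /andP[e0 e1] := e01 _ (hn j); rewrite [`|e_sum _ _|]ger0_norm //.
  rewrite -[leRHS]mulr1 ler_pM //.
  exact/ltW/(omega_close omega_dec omega_shape omega_I _ delta_gt0 omega_dist).
have : delta * k%:R <= delta * k.+1%:R by rewrite ler_pM2l // ler_nat.
by lra.
Qed.

End Recovery.

(** * Bringing two neighbouring components closer together *)

Section Smoothing.
Variable R : rcfType.
Implicit Types s t : seq R.

Lemma sorted_strict_step s : sorted >=%R s -> ~~ constant s ->
  exists s1 s2 a b, s = s1 ++ a :: b :: s2 /\ b < a.
Proof.
elim: s => // a [|b s] IH //= /andP[ba s_sorted]; rewrite negb_and.
have [abE|ne _] := eqVneq a b.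
  move: s_sorted IH; rewrite -abE /= => s_sorted IH /(IH s_sorted)[s1 [s2 [c [d [-> dc]]]]].
  by exists (a :: s1), s2, c, d.
by exists [::], s, a, b; split => //; rewrite lt_neqAle eq_sym ne.
Qed.

Lemma sorted_smoothing s t a b e : 0 <= e <= (a - b) / 2 ->
  sorted >=%R (s ++ a :: b :: t) -> sorted >=%R (s ++ (a - e) :: (b + e) :: t).
Proof.
move=> e_le; have [ea [be eab]] : a - e <= a /\ b <= b + e /\ b + e <= a - e by lra.
elim: s => [|x s IH] /=.
  rewrite eab; case: t => //= c t /and3P[_ cb ->]; rewrite andbT.
  exact: le_trans cb be.
case: s IH => [|y s] IH /andP[ax]; last by move=> /IH /= ->; rewrite andbT.
by move=> /IH /= ->; rewrite andbT; exact: le_trans ea ax.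
Qed.

Lemma sum_smoothing s t a b e :
  \sum_(c <- s ++ (a - e) :: (b + e) :: t) c = \sum_(c <- s ++ a :: b :: t) c.
Proof. by rewrite !big_cat !big_cons /=; ring. Qed.

(** Only the prefix that ends between the two moved components changes its sum: it loses [e]. *)
Lemma majorized_smoothing s t a b e : 0 <= e <= (a - b) / 2 ->
  sorted >=%R (s ++ a :: b :: t) ->
  majorized (s ++ (a - e) :: (b + e) :: t) (s ++ a :: b :: t).
Proof.
move=> e_le x_sorted; have y_sorted := sorted_smoothing e_le x_sorted.
have szE : size (s ++ (a - e) :: (b + e) :: t) = size (s ++ a :: b :: t).
  by rewrite !size_cat.
split=> // [l _|]; last by rewrite {2}szE !e_sum_full; exact: sum_smoothing.
rewrite /e_sum !decr_id // !take_cat; case: ifP => // _.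
case: (l - size s)%N => [|[|m]] //=; rewrite !big_cat ?take0 ?big_seq1 /= lerD2l.
  by lra.
by rewrite !big_cons; lra.
Qed.

Lemma eucl_dist_smoothing s t a b e : 0 <= e ->
  eucl_dist (s ++ (a - e) :: (b + e) :: t) (s ++ a :: b :: t) <= 2 * e.
Proof.
move=> e0; rewrite /eucl_dist zip_cat // big_cat /= !big_cons /=.
have zip_id u : \sum_(p <- zip u u) (p.1 - p.2) ^+ 2 = 0 :> R.
  by elim: u => [|c u IH] /=; rewrite ?big_nil // big_cons IH subrr expr0n addr0.
rewrite !zip_id -[leRHS]ger0_norm ?mulr_ge0 // -sqrtr_sqr ler_wsqrtr //.
(* The squared distance is 2 e^2, at most the square of 2 e. *)
have := sqr_ge0 e; lra.
Qed.

Lemma exists_smoothing k (chi : k.-tuple R) chis q delta :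
  sorted >=%R chi -> all (fun a => 0 <= a) chi -> decomposition chi chis ->
  ~~ constant (nth [::] chis q) -> 0 < delta ->
  exists (omega : k.-tuple R) omegas,
    [/\ [/\ sorted >=%R omega, all (fun a => 0 <= a) omega,
            \sum_(a <- omega) a = \sum_(a <- chi) a, majorized omega chi
          & omega <> chi],
        decomposition omega omegas, shape omegas = shape chis,
        (forall r, r != q -> nth [::] omegas r = nth [::] chis r)
      & eucl_dist (nth [::] omegas q) (nth [::] chis q) < delta /\
        vsum (nth [::] omegas q) = vsum (nth [::] chis q)].
Proof.
move=> chi_sorted chi_ge0 [chiE chis_ne] q_nonconst delta_gt0.
have qs : (q < size chis)%N.
  by rewrite ltnNge; apply: contra q_nonconst => sq; rewrite nth_default.
have chisE : chis = take q chis ++ nth [::] chis q :: drop q.+1 chis.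
  by rewrite -drop_nth // cat_take_drop.
have [s1 [s2 [a [b [qE ab]]]]] : exists s1 s2 a b, nth [::] chis q = s1 ++ a :: b :: s2 /\ b < a.
  by apply: sorted_strict_step q_nonconst; apply: sorted_block; rewrite chiE.
(* The first bound keeps the components in order; the second keeps the distance, at most 2 e, within
   delta / 2. *)
pose e := Num.min ((a - b) / 2) (delta / 4).
have e_gt0 : 0 < e by rewrite lt_min; apply/andP; split; lra.
have e_ab : e <= (a - b) / 2 by rewrite ge_min lexx.
have e_delta : e <= delta / 4 by rewrite ge_min lexx orbT.
have e_le : 0 <= e <= (a - b) / 2 by rewrite e_ab ltW.
pose B := s1 ++ (a - e) :: (b + e) :: s2.
pose omegas := take q chis ++ B :: drop q.+1 chis.
pose X := flatten (take q chis) ++ s1; pose Y := s2 ++ flatten (drop q.+1 chis).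
have chiXY : tval chi = X ++ a :: b :: Y.
  by rewrite -chiE {1}chisE flatten_cat /= qE /X /Y -!catA.
have omegaXY : flatten omegas = X ++ (a - e) :: (b + e) :: Y.
  by rewrite /omegas flatten_cat /= /B /X /Y -!catA.
have omega_size : size (flatten omegas) == k.
  by rewrite omegaXY -(size_tuple chi) chiXY !size_cat.
rewrite chiXY in chi_sorted chi_ge0.
have [omega omegaE] : exists omega : k.-tuple R, tval omega = flatten omegas.
  by exists (Tuple omega_size).
exists omega, omegas; split.
- rewrite omegaE omegaXY chiXY; split.
  + exact: sorted_smoothing e_le chi_sorted.
  + move: chi_ge0; rewrite !all_cat /= => /and4P[-> a0 b0 ->]; rewrite !andbT /=.
    by apply/andP; split; lra.
  + exact: sum_smoothing.
  + exact: majorized_smoothing e_le chi_sorted.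
  + move=> /(congr1 val) /=; rewrite omegaE omegaXY chiXY => /eqP.
    by rewrite eqseq_cat // eqxx /= eqseq_cons => /andP[/eqP]; lra.
- split=> //; apply: contra chis_ne; rewrite chisE !mem_cat !inE => /or3P[->|/eqP|->] //.
    by rewrite /B; case: (s1).
  by rewrite !orbT.
- by rewrite /omegas {3}chisE /shape !map_cat /= qE /B !size_cat.
- move=> r rq; rewrite /omegas {3}chisE !nth_cat; case: ifP => // /negbT.
  rewrite size_takel ?(ltnW qs) // -leqNgt leq_eqVlt eq_sym (negbTE rq) /= -subn_gt0.
  by case: (r - q)%N.
- have -> : nth [::] omegas q = B.
    by rewrite /omegas nth_cat size_takel ?(ltnW qs) // ltnn subnn.
  rewrite qE; split; last exact: sum_smoothing.
  by apply: le_lt_trans (eucl_dist_smoothing _ _ _ _ (ltW e_gt0)) _; lra.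
Qed.

End Smoothing.

(** * Assembly of the recovered state and of the protocol *)

Theorem theorem4p2 (R : rcfType) (n k : nat)
  (Psi Phi : 'M[R[i]]_n) (Chi : 'M[R[i]]_k)
  (psi phi : n.-tuple R) (chi : k.-tuple R)
  (psis phis chis : seq (seq R)) :
  state_with_schmidt Psi psi ->
  state_with_schmidt Phi phi ->
  state_with_schmidt Chi chi ->
  majorized psi phi ->
  normal_decompositions psi phi psis phis ->
  all (fun a => 0 < a) chi ->
  ~~ max_entangled chi ->
  decomposition chi chis ->
  size chis = size (groups psis phis) ->
  (forall (i : nat) (J : seq nat) (J_i : nat),
     i \in I_set psis phis -> J \in D_grp psis phis -> nearest i J J_i ->
     ratio_embeds (gblock psis phis chis [:: i]) (gblock psis phis chis J)
                  (block phis i) (block phis J_i)) ->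
  \big[Num.min/1]_(J <- D_grp psis phis) l_u (gblock psis phis chis J)
    > \big[Num.max/0]_(i <- D_set psis phis) g_u (block phis i) ->
  \big[Num.min/1]_(i <- I_set psis phis) l_u (gblock psis phis chis [:: i])
    > \big[Num.max/0]_(J <- D_grp psis phis)
        Num.max (g_u (block phis (max_idx J))) (g_u (block phis (min_idx J))) ->
  ((exists2 J, J \in D_grp psis phis & ~~ constant (gblock psis phis chis J)) ->
   partial_recovery psi phi chi)
  /\
  (exists2 delta : R, 0 < delta &
     forall (Omega : 'M[R[i]]_k) (omega : k.-tuple R) (omegas : seq (seq R)),
       state_with_schmidt Omega omega ->
       decomposition omega omegas ->
       shape omegas = shape chis ->
       (forall G, G \in I_grp psis phis ->
          gblock psis phis omegas G = gblock psis phis chis G) ->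
       (forall G, G \in D_grp psis phis ->
          eucl_dist (gblock psis phis omegas G) (gblock psis phis chis G) < delta /\
          vsum (gblock psis phis omegas G) = vsum (gblock psis phis chis G)) ->
       transforms (Psi *t Chi) (Phi *t Omega)).
Proof.
move=> Psi_psi Phi_phi Chi_chi psi_phi normal chi_gt0 _ chi_chis size_chis embeds l_u_D l_u_I.
have [psi_sorted _ psi_sum _] := Psi_psi; have [phi_sorted phi_ge0 phi_sum _] := Phi_phi.
have [chi_sorted chi_ge0 chi_sum _] := Chi_chi.
have [delta delta_gt0 delta_maj] := recovery_majorized psi_sorted phi_sorted phi_ge0
  chi_gt0 psi_sum phi_sum chi_sum psi_phi normal chi_chis size_chis embeds l_u_D l_u_I.
split; last first.
  exists delta => // Omega omega omegas Omega_omega omega_dec omega_shape omega_I omega_D.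
  have [_ _ omega_sum _] := Omega_omega.
  exact: majorized_transforms (delta_maj _ _ omega_sum omega_dec omega_shape omega_I omega_D).
move=> [J JD J_nonconst].
(* The recovered state smooths two unequal components of the non-constant block chi^J. It differs
   from chi, is majorized by it, and stays within delta of it with the same block sums. *)
have [omega [omegas [[omega_sorted omega_ge0 omega_sum omega_chi omega_ne]
  omega_dec omega_shape omega_other omega_J]]] :=
  exists_smoothing chi_sorted chi_ge0 chi_chis J_nonconst delta_gt0.
have index_other G : G \in groups psis phis -> G != J ->
    gblock psis phis omegas G = gblock psis phis chis G.
  move=> Ggr GJ; apply: omega_other; apply: contra GJ => /eqP GJ.
  have Jgr : J \in groups psis phis by rewrite mem_groups JD orbT.
  by rewrite -(nth_index [::] Ggr) GJ nth_index.
exists (1%:M *m diag_mx (\row_j (Num.sqrt (tnth omega j))%:C) *m 1%:M^T), omega.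
have unitary1 : (1%:M : 'M[R[i]]_k) \is unitarymx.
  by apply/unitarymxP; rewrite trmx1 map_mx1 mulmx1.
split=> //; last by rewrite !decr_id // => /val_inj.
- by split=> //; [rewrite omega_sum | exists 1%:M, 1%:M].
- apply: delta_maj omega_dec omega_shape _ _; first by rewrite omega_sum.
    move=> G GI; apply: index_other; first by rewrite mem_groups GI.
    (* An unchanged index cannot form the group [J], whose members all belong to strict blocks. *)
    apply: contraTneq GI => ->; apply/mapP => -[i iI JE].
    have := D_grp_D_set JD (s := i); rewrite JE mem_head mem_D_set => /(_ isT).
    by move: iI; rewrite mem_I_set => /andP[-> _].
  move=> G GD; have [->//|GJ] := eqVneq G J.
  rewrite index_other ?mem_groups ?GD ?orbT //; split=> //.
  suff -> : eucl_dist (gblock psis phis chis G) (gblock psis phis chis G) = 0 by [].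
  rewrite /eucl_dist big1_seq ?sqrtr0 // => p /andP[_].
  by elim: (gblock _ _ _ _) => //= c s IH; rewrite inE => /orP[/eqP->|/IH//]; rewrite subrr expr0n.
Qed.
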